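(* Let $\epsilon\in(0,1)$ and $0<\zeta<1$. Let $\mathcal F:(M_1,\tau)\to L^1(\mathcal X,\Sigma_{|\mathcal Y|})$ be continuous and satisfy: (i) for every $\nu\in M_1$ and every $x$ in the support of $\nu_x$, $\tfrac12\sum_y|\nu_{y|x}(y|x)-(\mathcal F\nu)(y|x)|\le\tfrac12\sum_y|p_{Y|X}(y|x)-(\mathcal F\nu)(y|x)|$; (ii) for every $\nu\in M_1$, $\mathbb E_{\nu}\big[\tfrac12\sum_y|\nu_{y|x}(y|x)-(\mathcal F\nu)(y|x)|\big]\le\zeta$. Let $L_m$ be the empirical measure of $m$ i.i.d. samples from $\mathbb P_{XY}$, $\mathbb P^m$ the induced law, and $\mathbb P_f=\mathcal F L_m$. Then $$\limsup_{m\to\infty}\frac1m\log\mathbb P^m\big(\bar\delta(\mathbb P_f)\ge\epsilon\big)\le 4\zeta-2\epsilon^2.$$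
   Context: $\mathcal X$ Polish, $\mathcal Y$ finite with discrete topology; $\mathbb P_{XY}$ is the true distribution with density $p(x,y)$, marginal $\mathbb P_X$ of full support, conditional $p_{Y|X}$. $M_1$ is the set of Borel probability measures on $\mathcal X\times\mathcal Y$; for $\nu\in M_1$, $\nu_x$ is its $\mathcal X$-marginal and $\nu_{y|x}$ its conditional (disintegration) on $\mathcal Y$. The $\tau$-topology on $M_1$ is generated by the sets $\{\nu:|\int f\,d\nu-r|<c\}$ for all bounded Borel measurable $f$, $r\in\mathbb R$, $c>0$. $\Sigma_{|\mathcal Y|}$ is the probability simplex on $\mathcal Y$; $L^1(\mathcal X,\Sigma_{|\mathcal Y|})$ is the set of measurable maps $\mathcal X\to\Sigma_{|\mathcal Y|}$ with metric $d(f,g)=\tfrac12\int\sum_y|f(y|x)-g(y|x)|\,d\mathbb P_X$. For a conditional $q(y|x)$, $\bar\delta(q):=\mathbb E_{\mathbb P_X}\big[\tfrac12\sum_y|p_{Y|X}(y|x)-q(y|x)|\big]$. *)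

(* Defs.v *)
From HB Require Import structures.
From mathcomp Require Import all_boot all_order all_algebra.
From mathcomp Require Import all_classical all_reals all_analysis.
Set Implicit Arguments.
Unset Strict Implicit.
Unset Printing Implicit Defensive.
Import Order.TTheory GRing.Theory Num.Theory.
Import numFieldNormedType.Exports.
Local Open Scope classical_set_scope.
Local Open Scope ring_scope.

Notation borelT X := (g_sigma_algebraType (@open X)).
Notation powT Y := (g_sigma_algebraType [set: set Y]).
Notation XYT X Y := (borelT X * powT Y)%type.

(* Polish space, presented by a compatible complete metric:
   X carries a complete pseudometric, is Hausdorff (so the pseudometric is a
   metric) and is separable. *)
Definition polish (R : realType) (X : completePseudoMetricType R) : Prop :=
  hausdorff_space X /\ exists D : set X, countable D /\ closure D = [set: X].

Definition topsupport (R : realType) (X : topologicalType)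
  (mu : set X -> \bar R) : set X :=
  [set x | forall U : set X, open U -> U x -> (0 < mu U)%E].

Section defs.
Context (R : realType) (X : completePseudoMetricType R) (Y : pointedType).

Definition marg (nu : set (XYT X Y) -> \bar R) : set X -> \bar R :=
  fun A => nu (A `*` [set: Y]).

Definition tv (p q : Y -> R) : R := 2^-1 * \sum_(y \in [set: Y]) `|p y - q y|.

(* f : X -> Y -> R is (pointwise) a measurable map X -> Sigma_|Y|,
   i.e. an element (representative) of L^1(X, Sigma_|Y|). *)
Definition simplex_map (f : X -> Y -> R) : Prop :=
  (forall x y, 0 <= f x y) /\ (forall x, \sum_(y \in [set: Y]) f x y = 1) /\
  (forall y, measurable_fun [set: borelT X] (fun x => f x y)).

(* k is a conditional (disintegration) nu_{y|x} of nu: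
   nu(A x {y}) = int_A k(y|x) d nu_x(x)  for all Borel A and all y. *)
Definition disintegration (nu : probability (XYT X Y) R) (k : X -> Y -> R) :=
  simplex_map k /\
  forall (A : set (borelT X)) (y : Y), measurable A ->
    nu (A `*` [set y]) = (\int[nu]_(z in A `*` [set: Y]) (k z.1 y)%:E)%E.

(* The metric of L^1(X, Sigma_|Y|) (w.r.t. the true marginal P_X):
   d(f,g) = E_{P_X}[ 1/2 sum_y |f(y|x) - g(y|x)| ]. *)
Definition L1dist (PXY : probability (XYT X Y) R) (f g : X -> Y -> R) : \bar R :=
  (\int[PXY]_z (tv (f z.1) (g z.1))%:E)%E.

Definition delta_bar (PXY : probability (XYT X Y) R) (pYX q : X -> Y -> R) :=
  L1dist PXY pYX q.

Definition bounded_measurable (f : XYT X Y -> R) : Prop :=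
  measurable_fun [set: XYT X Y] f /\ exists M : R, forall z, `|f z| <= M.

Definition tau_basic (f : XYT X Y -> R) (r c : R) :
  set (probability (XYT X Y) R) :=
  [set nu | (`| \int[nu]_z (f z)%:E - r%:E | < c%:E)%E].

(* Continuity of F : (M_1, tau) -> L^1(X, Sigma_|Y|) (metric L1dist),
   unfolded: every nu0 and e > 0 admit a basic tau-neighbourhood of nu0
   (a finite intersection of subbasic sets containing nu0) mapped into the
   e-ball around F nu0. *)
Definition tau_continuous (PXY : probability (XYT X Y) R)
  (F : probability (XYT X Y) R -> X -> Y -> R) : Prop :=
  forall (nu0 : probability (XYT X Y) R) (e : R), 0 < e ->
    exists (k : nat) (f : 'I_k -> XYT X Y -> R) (r c : 'I_k -> R),
      (forall i, bounded_measurable (f i) /\ 0 < c i /\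
                 tau_basic (f i) (r i) (c i) nu0) /\
      (forall nu, (forall i, tau_basic (f i) (r i) (c i) nu) ->
                  (L1dist PXY (F nu) (F nu0) < e%:E)%E).

End defs.

Definition iid_seq (R : realType) (dO : measure_display) (Om : measurableType dO)
  (dT : measure_display) (T : measurableType dT)
  (P : probability Om R) (Z : nat -> Om -> T) (Q : probability T R) : Prop :=
  (forall i, measurable_fun [set: Om] (Z i)) /\
  (forall i (A : set T), measurable A -> P (Z i @^-1` A) = Q A) /\
  (forall (s : seq nat) (A : nat -> set T), uniq s ->
     (forall i, measurable (A i)) ->
     P (\bigcap_(i in [set i | i \in s]) (Z i @^-1` A i)) =
     (\big[*%E/1%E]_(i <- s) P (Z i @^-1` A i))%E).

Definition empirical (R : realType) (dO : measure_display) (Om : measurableType dO)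
  (dT : measure_display) (T : measurableType dT)
  (Z : nat -> Om -> T) (L : nat -> Om -> probability T R) : Prop :=
  forall (m : nat) (w : Om) (A : set T), (0 < m)%N -> measurable A ->
    L m w A = (m%:R^-1 * \sum_(i < m) \1_A (Z i w))%:E.

(* Outer probability P^*(E) = inf { P(B) : B measurable, E <= B }
   (equals P(E) when E is measurable). *)
Definition outer_prob (R : realType) (dO : measure_display) (Om : measurableType dO)
  (P : probability Om R) (E : set Om) : \bar R :=
  ereal_inf [set P B | B in [set B | measurable B /\ E `<=` B]].

Definition scaled_log (R : realType) (m : nat) (p : \bar R) : \bar R :=
  match p with
  | r%:E => if 0 < r then (ln r / m%:R)%:E else -oo%E
  | +oo%E => +oo%E
  | -oo%E => -oo%E
  end.

(* Main.v *)
Require Import Defs.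
From HB Require Import structures.
From mathcomp Require Import all_boot all_order all_algebra.
From mathcomp Require Import all_classical all_reals all_analysis.
From mathcomp Require Import finmap measurable_realfun ring lra.
Import Order.TTheory GRing.Theory Num.Theory.
Import numFieldNormedType.Exports.
Local Open Scope classical_set_scope.
Local Open Scope ring_scope.

(* Fix [c < 2 eps^2 - 4 zeta] and call a set of probabilities thin when the
   empirical measures visit it with probability [O(e^(- c m))]. Thin sets form
   an ideal which, by Chernoff's bound, contains the half-spaces
   [int f dnu >= r] with [r - log E e^f > c]. If the event of the theorem were
   not thin, an ultrafilter avoiding all thin sets would have a set-wise limit
   [nu]: the half-spaces of multiples of indicators force [nu] to be countably
   additive, tau-continuity keeps [nu] in the event, and
   [int f dnu <= log E e^f + c] for every bounded measurable [f].
   With [q = F nu], [A_x = {y | p(y|x) < q(y|x)}], [a = p(A_x)], [b = q(A_x)],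
   so that [g = b - a] is the total variation distance of [p] and [q], this
   fails for [f(x, y) = l(g(x)) (1_(A_x)(y) - b(x))], [0 <= l <= 4]: by (ii) its
   [nu]-integral is at least [- 4 zeta], and
   [E e^f = E (e^(- l b) (1 - a + a e^l)) <= e^(- 2 eps^2)] for a suitable [l].
   The choice [l = 4 g] gives [E e^(- 2 g^2)] by Hoeffding's lemma, but
   [e^(- 2 g^2)] is not concave on [[0, 1]], so Jensen's inequality does not
   apply; [l] is chosen so that the integrand lies below an affine function of
   [g] which is decreasing and at most [e^(- 2 eps^2)] at [g = eps]. *)

Set Implicit Arguments.
Unset Strict Implicit.
Unset Printing Implicit Defensive.

(** * Moment generating functions of Bernoulli variables *)

Lemma is_derive_ge0_le {R : realType} (f df : R -> R) (a b : R) :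
  (forall x : R, a <= x <= b -> is_derive x 1 f (df x)) ->
  (forall x, a <= x <= b -> 0 <= df x) -> a <= b -> f a <= f b.
Proof.
move=> fdf df0 ab.
have fd x : x \in `[a, b] -> derivable f x 1.
  by rewrite in_itv/= => /fdf ?; exact: ex_derive.
have fD x : x \in `]a, b[ -> is_derive x 1 f (df x).
  by rewrite in_itv/= => /andP[? ?]; apply: fdf; rewrite !ltW.
have [c cab] := MVT_segment ab fD (derivable_within_continuous fd).
move=> e; rewrite -subr_ge0 e mulr_ge0 ?subr_ge0//; apply: df0.
by move: cab; rewrite in_itv.
Qed.

Lemma is_derive_le0_ge {R : realType} (f df : R -> R) (a b : R) :
  (forall x : R, a <= x <= b -> is_derive x 1 f (df x)) ->
  (forall x, a <= x <= b -> df x <= 0) -> a <= b -> f b <= f a.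
Proof.
move=> fdf df0 ab; rewrite -lerN2.
apply: (@is_derive_ge0_le _ (- f) (- df)) => // x xab.
  by have ? := fdf x xab; exact: is_deriveN.
by rewrite /= oppr_ge0 df0.
Qed.

(** The odd degree makes this a lower bound of [e^x] on the whole line. It is the source of all
    numerical estimates of exponentials below. *)
Definition taylor5 {R : realType} (x : R) :=
  1 + x + x ^+ 2 / 2 + x ^+ 3 / 6 + x ^+ 4 / 24 + x ^+ 5 / 120.

(** The derivative of [taylor5 y * e^(- y)] is [- (y^5 / 120) e^(- y)], so this product is largest
    at [y = 0], where it equals [1]. *)
Lemma expR_ge_taylor5 {R : realType} (x : R) : taylor5 x <= expR x.
Proof.
pose v (y : R) := taylor5 y * expR (- y).
have dv (y : R) : is_derive y 1 v (- (y ^+ 5 / 120) * expR (- y)).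
  rewrite /v /taylor5; apply: is_derive_eq.
  by rewrite /GRing.scale/= !mulr0; field.
suff : v x <= v 0.
  rewrite /v {2}/taylor5 oppr0 expR0 !expr0n/= !mul0r !addr0 mulr1 expRN.
  by rewrite ler_pdivrMr ?expR_gt0// mul1r.
have [x0|/ltW x0] := leP 0 x.
- apply: (is_derive_le0_ge (fun y _ => dv y)) => // y /andP[y0 _].
  by rewrite mulNr oppr_le0 mulr_ge0 ?expR_ge0// divr_ge0 ?exprn_ge0.
- apply: (is_derive_ge0_le (fun y _ => dv y)) => // y /andP[_ y0].
  rewrite mulr_ge0 ?expR_ge0// oppr_ge0 ler_pdivrMr ?mul0r//.
  by rewrite exprS mulr_le0_ge0// exprn_even_ge0.
Qed.

(* The logarithmic derivative [v = 1 - (1 - a) / D] of [D] satisfies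
   [v' = v (1 - v) <= 1/4], so [u = z / 4 + 1 - v] is nondecreasing. *)
Lemma bernoulli_mgf_le {R : realType} (a l : R) : 0 <= a <= 1 -> 0 <= l ->
  expR (- (l * a)) * (1 - a + a * expR l) <= expR (l ^+ 2 / 8).
Proof.
move=> /andP[a0 a1] l0.
pose D (z : R) := 1 - a + a * expR z.
have D0 z : 0 < D z.
  rewrite /D; have := expR_gt0 z; nra.
have D00 z : D z != 0 by rewrite gt_eqF.
pose u (z : R) := z / 4 + (1 - a) * (D z)^-1.
have dD (z : R) : is_derive z 1 D (a * expR z).
  by rewrite /D; apply: is_derive_eq; rewrite /GRing.scale/=; ring.
have du (z : R) : is_derive z 1 u (1 / 4 - (1 - a) * (a * expR z) / D z ^+ 2).
  by rewrite /u; apply: is_derive_eq; rewrite /GRing.scale/=; field; rewrite D00.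
have u0 z : 0 <= z -> 1 - a <= u z.
  move=> z0; have -> : 1 - a = u 0.
    by rewrite /u /D mul0r add0r expR0 mulr1 subrK invr1 mulr1.
  apply: (is_derive_ge0_le (fun y _ => du y)) => // y _.
  rewrite subr_ge0 ler_pdivrMr ?exprn_gt0//.
  rewrite /D; have := sqr_ge0 (1 - a - a * expR y); nra.
(* Here [v] is, up to the factor [e^(- z a)], the quotient of [D] by [e^(z^2 / 8)]; its logarithmic
   derivative is [1 - a - u z <= 0]. *)
pose v (z : R) := D z * expR (- (z ^+ 2 / 8) - z * a).
have dv (z : R) : is_derive z 1 v
    ((1 - a - u z) * (D z * expR (- (z ^+ 2 / 8) - z * a))).
  rewrite /v; apply: is_derive_eq; rewrite /GRing.scale/= /u.
  rewrite (_ : a * expR z = D z - (1 - a)); last by rewrite /D; ring.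
  by rewrite !mulr0; field; rewrite D00.
have : v l <= v 0.
  apply: (is_derive_le0_ge (fun y _ => dv y)) => // y /andP[y0 _].
  by rewrite mulr_le0_ge0 ?subr_le0 ?u0// mulr_ge0 ?expR_ge0// ltW.
rewrite /v {2}/D !expr0n/= !mul0r subr0 oppr0 expR0 !mulr1 subrK.
by rewrite expRD expRN mulrCA ler_pdivrMl ?expR_gt0// mulr1 mulrC.
Qed.

(** Inverting the lower bound for [e^(- x)] gives an upper bound for [e^x]; splitting [x] into
    [n + 1] equal parts keeps the polynomial accurate. *)
Lemma expR_le_taylor5 {R : realType} (n : nat) (x : R) :
  0 < taylor5 (- x / n.+1%:R) -> expR x <= (taylor5 (- x / n.+1%:R) ^+ n.+1)^-1.
Proof.
move=> T0; rewrite -[leLHS]invrK -expRN lef_pV2 ?posrE ?exprn_gt0 ?expR_gt0//.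
rewrite [in leRHS](_ : - x = n.+1%:R * (- x / n.+1%:R)); last first.
  by rewrite mulrCA divff ?mulr1.
rewrite expRM_natl; apply: lerXn2r; rewrite ?nnegrE ?expR_ge0 ?(ltW T0)//.
exact: expR_ge_taylor5.
Qed.

(* [1 + a K <= (K / l) e^(l / K + l a - 1)] by tangency of [t <= e^(t - 1)]. *)
Lemma mgf_le_uniform {R : realType} (a b l K : R) : 0 < l -> 0 < K -> 0 <= a ->
  expR l <= 1 + K ->
  expR (- (l * b)) * (1 - a + a * expR l) <=
  K / l * expR (l / K - 1 - l * (b - a)).
Proof.
move=> l0 K0 a0 lK.
have -> : l / K - 1 - l * (b - a) = - (l * b) + (l / K + l * a - 1) by ring.
rewrite expRD mulrCA ler_wpM2l ?expR_ge0//.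
set t := l / K + l * a - 1.
have E : 1 + a * K = K / l * (1 + t) by rewrite /t; field; rewrite !gt_eqF.
have : K / l * (1 + t) <= K / l * expR t.
  by rewrite ler_wpM2l ?expR_ge1Dx// ltW// divr_gt0.
rewrite -E; apply: le_trans; nra.
Qed.

(** Convexity of the exponential: the tangent bounds at [g], taken at [g0] and [g1] and weighted by
    [g1 - g] and [g - g0], add up to the claim. *)
Lemma expR_chord {R : realType} (c l p s g0 g1 g : R) : g0 < g1 -> g0 <= g <= g1 ->
  expR (c - l * g0) <= p - s * g0 -> expR (c - l * g1) <= p - s * g1 ->
  expR (c - l * g) <= p - s * g.
Proof.
move=> g01 /andP[gg0 gg1] e0 e1.
rewrite -(ler_pM2l (_ : 0 < g1 - g0)) ?subr_gt0//.
have E h : expR (c - l * g) * (1 + l * (g - h)) <= expR (c - l * h).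
  have -> : c - l * h = (c - l * g) + l * (g - h) by ring.
  by rewrite [leRHS]expRD ler_wpM2l ?expR_ge0 ?expR_ge1Dx.
have := E g0; have := E g1; nra.
Qed.

(* The tangent at [e] of [g |-> e^(- 2 g^2)]. *)
Definition gauss_tangent {R : realType} (e g : R) :=
  expR (- (2 * e ^+ 2)) * (1 - 4 * e * (g - e)).

(** By [mgf_le_uniform] the left side is at most [(K / l) e^(l / K - 1 - l g)] with [g = b - a].
    This is convex in [g], so comparing it with the affine right side at [g0] and [g1] is enough.
    The last five hypotheses are rational certificates, within reach of [lra], of [e^l <= 1 + K] and
    of the two endpoint inequalities. The constants [18/25], [61/25], [12/5] are [2 d^2],
    [1 + 4 d^2], [4 d] at [d = 3/5]. *)
Lemma mgf_cell {R : realType} (l K g0 g1 a b : R) :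
  let y g := (1 + l * g - l / K - 18 / 25) / 2 in
  0 < l -> 0 < K -> g0 < g1 -> 0 <= a -> g0 <= b - a <= g1 ->
  0 < taylor5 (- l / 8) -> 1 <= (1 + K) * taylor5 (- l / 8) ^+ 8 ->
  0 < taylor5 (y g0) -> K / l <= (61 / 25 - 12 / 5 * g0) * taylor5 (y g0) ^+ 2 ->
  0 < taylor5 (y g1) -> K / l <= (61 / 25 - 12 / 5 * g1) * taylor5 (y g1) ^+ 2 ->
  expR (- (l * b)) * (1 - a + a * expR l) <= gauss_tangent (3 / 5) (b - a).
Proof.
move=> y l0 K0 g01 a0 gab tl hl t0 h0 t1 h1.
have lK : expR l <= 1 + K.
  apply: (le_trans (@expR_le_taylor5 _ 7 l tl)).
  by rewrite -[leLHS]mul1r ler_pdivrMr ?exprn_gt0.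
apply: (le_trans (mgf_le_uniform _ l0 K0 a0 lK)).
have end_le g : 0 < taylor5 (y g) ->
    K / l <= (61 / 25 - 12 / 5 * g) * taylor5 (y g) ^+ 2 ->
    expR ((18 / 25 + l / K - 1) - l * g) <=
    l / K * (61 / 25) - l / K * (12 / 5) * g.
  move=> ty hy.
  have yE : - ((18 / 25 + l / K - 1) - l * g) / 2 = y g by rewrite /y; lra.
  have := @expR_le_taylor5 _ 1 ((18 / 25 + l / K - 1) - l * g).
  rewrite yE => /(_ ty) /le_trans; apply.
  have -> : l / K * (61 / 25) - l / K * (12 / 5) * g =
    l / K * (61 / 25 - 12 / 5 * g) by ring.
  rewrite -[leLHS]mul1r ler_pdivrMr ?exprn_gt0//.
  have r0 : 0 <= l / K by rewrite ltW ?divr_gt0.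
  have := ler_wpM2l r0 hy; rewrite [in leRHS]mulrA; apply: le_trans.
  by rewrite -[l / K]invf_div mulVf// gt_eqF ?divr_gt0.
have := expR_chord g01 gab (end_le _ t0 h0) (end_le _ t1 h1).
have -> : l / K - 1 - l * (b - a) =
    - (18 / 25) + ((18 / 25 + l / K - 1) - l * (b - a)) by ring.
have -> : gauss_tangent (3 / 5) (b - a) =
    expR (- (18 / 25)) * (61 / 25 - 12 / 5 * (b - a)).
  by rewrite /gauss_tangent; congr (expR _ * _); lra.
move=> h; rewrite expRD mulrCA ler_wpM2l ?expR_ge0//.
rewrite -ler_pdivlMl ?divr_gt0// invf_div.
apply: le_trans h _; rewrite le_eqVlt; apply/orP; left; apply/eqP; ring.
Qed.

(** The quotient of the tangent by the Gaussian. Its derivative has the sign of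
    [(g - e) (1 - 4 e g)], so comparing the two amounts to following its monotonicity from the value
    [1] at [g = e]. *)
Definition gauss_ratio {R : realType} (e g : R) :=
  (1 - 4 * e * (g - e)) * expR (2 * (g ^+ 2 - e ^+ 2)).

Lemma gauss_tangentE {R : realType} (e g : R) :
  gauss_tangent e g = expR (- (2 * g ^+ 2)) * gauss_ratio e g.
Proof.
rewrite /gauss_tangent /gauss_ratio [RHS]mulrCA -expRD [LHS]mulrC; congr (_ * expR _); ring.
Qed.

Lemma is_derive_gauss_ratio {R : realType} (e g : R) :
  is_derive g 1 (gauss_ratio e)
    (4 * (g - e) * (1 - 4 * e * g) * expR (2 * (g ^+ 2 - e ^+ 2))).
Proof.
rewrite /gauss_ratio; apply: is_derive_eq; rewrite /GRing.scale/=; ring.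
Qed.

Lemma gauss_ratio_id {R : realType} (e : R) : gauss_ratio e e = 1.
Proof. by rewrite /gauss_ratio !subrr !mulr0 subr0 expR0 mul1r. Qed.

(** Since [e <= 1/2], the ratio decreases up to [e] and increases from there as long as
    [4 e g <= 1]; its minimum is thus [1]. *)
Lemma gauss_tangent_ge {R : realType} (e g : R) :
  0 <= e -> 4 * e ^+ 2 <= 1 -> 0 <= g -> 4 * e * g <= 1 ->
  expR (- (2 * g ^+ 2)) <= gauss_tangent e g.
Proof.
move=> e0 e1 g0 g1.
rewrite gauss_tangentE -[leLHS]mulr1 ler_wpM2l ?expR_ge0// -(gauss_ratio_id e).
have [eg|/ltW ge] := leP e g.
- apply: (is_derive_ge0_le (fun y _ => is_derive_gauss_ratio e y)) => // y.
  move=> /andP[ey yg]; have ? : e * y <= e * g by rewrite ler_wpM2l.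
  by rewrite !mulr_ge0 ?expR_ge0//; lra.
- apply: (is_derive_le0_ge (fun y _ => is_derive_gauss_ratio e y)) => // y.
  move=> /andP[gy ye]; have ey : e * y <= e ^+ 2 by rewrite expr2 ler_wpM2l.
  by rewrite mulr_le0_ge0 ?expR_ge0//; rewrite mulr_le0_ge0//; lra.
Qed.

(** The critical points are [5/12] and [3/5]. On [[5/12, 1]] the maximum is [1], at [3/5]; on
    [[7/20, 5/12]] the ratio decreases, and its value at [7/20] is just below [1]. *)
Lemma gauss_ratio_le1 {R : realType} (g : R) : 7 / 20 <= g <= 1 ->
  gauss_ratio (3 / 5) g <= 1.
Proof.
move=> /andP[g0 g1].
pose dr y := @is_derive_gauss_ratio R (3 / 5) y.
have [g2|/ltW g2] := leP g (5 / 12).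
  apply: (@le_trans _ _ (gauss_ratio (3 / 5) (7 / 20))).
    apply: (is_derive_le0_ge (fun y _ => dr y)) => // y /andP[gy ye].
    by rewrite mulr_le0_ge0 ?expR_ge0//; nra.
  rewrite /gauss_ratio (_ : 2 * _ = - (19 / 40)); last by field.
  rewrite expRN ler_pdivrMr ?expR_gt0// mul1r.
  by have := expR_ge_taylor5 (19 / 40 : R); rewrite /taylor5; lra.
rewrite -[leRHS](gauss_ratio_id (3 / 5)).
have [eg|/ltW ge] := leP (3 / 5) g.
- apply: (is_derive_le0_ge (fun y _ => dr y)) => // y /andP[ey yg].
  by rewrite mulr_le0_ge0 ?expR_ge0//; nra.
- apply: (is_derive_ge0_le (fun y _ => dr y)) => // y /andP[gy ye].
  by rewrite mulr_ge0 ?expR_ge0//; nra.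
Qed.

(** The ratio decreases up to [5/12], and at [31/100] it is still slightly above [1]. *)
Lemma gauss_ratio_ge1 {R : realType} (g : R) : 0 <= g <= 31 / 100 ->
  1 <= gauss_ratio (3 / 5) g.
Proof.
move=> /andP[g0 g1].
apply: (@le_trans _ _ (gauss_ratio (3 / 5) (31 / 100))).
  rewrite /gauss_ratio (_ : 2 * _ = - (2639 / 5000)); last by field.
  have := @expR_ge_taylor5 R (- (2639 / 5000)).
  by rewrite /taylor5; lra.
apply: (is_derive_le0_ge (fun y _ => is_derive_gauss_ratio (3 / 5) y)) => // y.
by move=> /andP[gy ye]; rewrite mulr_le0_ge0 ?expR_ge0//; nra.
Qed.

(** Hoeffding's bound has exponent [- l g + l^2 / 8] with [g = b - a]; it is least at [l = 4 g],
    with value [- 2 g^2]. *)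
Lemma bernoulli_mgf_gauss {R : realType} (a b : R) : 0 <= a -> a <= b -> b <= 1 ->
  expR (- (4 * (b - a) * b)) * (1 - a + a * expR (4 * (b - a))) <=
  expR (- (2 * (b - a) ^+ 2)).
Proof.
move=> a0 ab b1.
have -> : - (4 * (b - a) * b) = - (4 * (b - a) ^+ 2) + - (4 * (b - a) * a) by ring.
have -> : - (2 * (b - a) ^+ 2) = - (4 * (b - a) ^+ 2) + (4 * (b - a)) ^+ 2 / 8 by field.
rewrite !expRD -mulrA ler_wpM2l ?expR_ge0// bernoulli_mgf_le//.
  by rewrite a0 (le_trans ab).
by rewrite mulr_ge0// subr_ge0.
Qed.

(** At [g = b - a = 1] the two sides are about [0.0183] and [0.0195], and [mgf_le_uniform] is too
    weak there. The left side is estimated directly instead, using that [a] and [1 - b] are at most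
    [1/5]. *)
Lemma bernoulli_mgf_top {R : realType} (a b : R) : 0 <= a -> 4 / 5 <= b - a -> b <= 1 ->
  expR (- (4 * b)) * (1 - a + a * expR 4) <= gauss_tangent (3 / 5) (b - a).
Proof.
move=> a0 ab b1.
pose t : R := expR (- 4).
have e4 : expR 4 = t^-1 by rewrite /t expRN invrK.
have t0 : 0 < t by rewrite expR_gt0.
(* Obtained by squaring the estimate [e^(1/2) >= 659/400] three times. *)
have t1 : t <= 37 / 2000.
  rewrite /t expRN -[leLHS]mul1r ler_pdivrMr ?expR_gt0//.
  have sq (c d x : R) : 0 <= c -> c <= expR x -> d <= c ^+ 2 -> d <= expR (2%:R * x).
    move=> c0 cx dc; rewrite expRM_natl (le_trans dc)//.
    by rewrite lerXn2r ?nnegrE ?expR_ge0.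
  have h0 : 659 / 400 <= expR (1 / 2 : R).
    by have := expR_ge_taylor5 (1 / 2 : R); rewrite /taylor5; lra.
  have h1 : 2714 / 1000 <= expR (2%:R * (1 / 2) : R) by apply: sq h0 _; lra.
  have h2 : 736 / 100 <= expR (2%:R * (2%:R * (1 / 2)) : R) by apply: sq h1 _; lra.
  have : 541 / 10 <= expR (2%:R * (2%:R * (2%:R * (1 / 2))) : R) by apply: sq h2 _; lra.
  by rewrite (_ : 2%:R * _ = 4); [lra|field].
have h : 243 / 500 <= expR (- (18 / 25)) :> R.
  have -> : - (18 / 25) = 2%:R * (- (9 / 25)) :> R by field.
  rewrite expRM_natl; have := expR_ge_taylor5 (- (9 / 25) : R); rewrite /taylor5; nra.
have -> : gauss_tangent (3 / 5) (b - a) = expR (- (18 / 25)) * (61 / 25 - 12 / 5 * (b - a)).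
  by rewrite /gauss_tangent; congr (expR _ * _); lra.
have -> : - (4 * b) = - 4 + 4 * (1 - b) by ring.
rewrite expRD -/t e4 -mulrA mulrCA.
have -> : t * (1 - a + a * t^-1) = t * (1 - a) + a by field; rewrite gt_eqF.
have d4 : expR (4 * (1 - b)) <= (1 - 4 * (1 - b))^-1.
  rewrite -[leLHS]invrK -expRN lef_pV2 ?posrE ?expR_gt0//; last by lra.
  exact: expR_ge1Dx.
apply: (@le_trans _ _ ((1 - 4 * (1 - b))^-1 * (t * (1 - a) + a))).
  by rewrite ler_wpM2r//; nra.
rewrite ler_pdivrMl; last by lra.
(* For a given [g = b - a] the worst case is [b = 1], [a = 1 - g], where [t (1 - a) + a] equals
   [t g + 1 - g]. *)
apply: (@le_trans _ _ ((1 - 4 * (1 - b)) * (t * (b - a) + 1 - (b - a)))).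
  have tg : t * (b - a) <= t by rewrite ler_piMr ?(ltW t0)//; lra.
  have : 4 * (t * (b - a) + 1 - (b - a)) <= 1 - t by lra.
  move=> /(ler_wpM2l (_ : 0 <= 1 - b)) h4; have {}h4 := h4 ltac:(lra).
  lra.
by rewrite ler_wpM2l//; nra.
Qed.

(* [4 g] is Hoeffding's choice; the constants approximate the optimal choice,
   where [4 g] does not suffice, on intervals on which [mgf_cell] applies. *)
Definition tilt {R : realType} (e g : R) : R :=
  if (e <= 7 / 20) then (if g <= 7 / 10 then 4 * g else 4)
  else if g <= 31 / 100 then 4 * g
  else if g <= 37 / 100 then 29 / 20
  else if g <= 47 / 100 then 17 / 10
  else if g <= 7 / 10 then 12 / 5
  else 4.

Lemma bernoulli_mgf_tilt4 {R : realType} (a b : R) : 0 <= a -> 7 / 10 < b - a -> b <= 1 ->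
  expR (- (4 * b)) * (1 - a + a * expR 4) <= gauss_tangent (3 / 5) (b - a).
Proof.
move=> a0 ab b1; have [h|/ltW h] := leP (4 / 5) (b - a).
  exact: bernoulli_mgf_top.
(* [K = 2681/50] is [e^4 - 1] rounded up. *)
by apply: (@mgf_cell _ _ (2681 / 50) (7 / 10) (4 / 5)); rewrite /taylor5; lra.
Qed.

(** For these [e] the tangent at [3/5] serves uniformly. Hoeffding's choice stays below it only for
    small [g]; the remaining range is cut into cells with constant tilt. *)
Lemma bernoulli_mgf_tilt_large {R : realType} (e a b : R) : 7 / 20 < e ->
  0 <= a -> a <= b -> b <= 1 ->
  expR (- (tilt e (b - a) * b)) * (1 - a + a * expR (tilt e (b - a))) <=
  gauss_tangent (3 / 5) (b - a).
Proof.
move=> e0 a0 ab b1; rewrite /tilt (lt_geF e0).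
case: ifPn => [g31|].
  apply: le_trans (bernoulli_mgf_gauss a0 ab b1) _.
  rewrite gauss_tangentE -[leLHS]mulr1 ler_wpM2l ?expR_ge0// gauss_ratio_ge1//.
  by rewrite subr_ge0 ab.
rewrite -ltNge => g31; case: ifPn => [g37|].
  (* In each cell [K] is [e^l - 1] rounded up, for the tilt [l] of that cell. *)
  by apply: (@mgf_cell _ _ (408 / 125) (31 / 100) (37 / 100)); rewrite /taylor5; lra.
rewrite -ltNge => g37; case: ifPn => [g47|].
  by apply: (@mgf_cell _ _ (2237 / 500) (37 / 100) (47 / 100)); rewrite /taylor5; lra.
rewrite -ltNge => g47; case: ifPn => [g7|].
  by apply: (@mgf_cell _ _ (401 / 40) (47 / 100) (7 / 10)); rewrite /taylor5; lra.
by rewrite -ltNge => g7; exact: bernoulli_mgf_tilt4.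
Qed.

(** Here the tangent is taken at [e] itself. For [g <= 7/10] one has [4 e g <= 49/50], so
    Hoeffding's choice and [gauss_tangent_ge] suffice; beyond, the tangent at [3/5] lies below the
    tangent at [e]. *)
Lemma bernoulli_mgf_tilt_small {R : realType} (e a b : R) : 0 <= e <= 7 / 20 ->
  0 <= a -> a <= b -> b <= 1 ->
  expR (- (tilt e (b - a) * b)) * (1 - a + a * expR (tilt e (b - a))) <=
  gauss_tangent e (b - a).
Proof.
move=> /andP[e0 e1] a0 ab b1; rewrite /tilt e1.
have g0 : 0 <= b - a by rewrite subr_ge0.
case: ifPn => [g7|].
  apply: le_trans (bernoulli_mgf_gauss a0 ab b1) _.
  by apply: gauss_tangent_ge => //; nra.
rewrite -ltNge => g7.
apply: le_trans (bernoulli_mgf_tilt4 a0 g7 b1) _.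
have -> : gauss_tangent (3 / 5) (b - a) = expR (- (18 / 25)) * (61 / 25 - 12 / 5 * (b - a)).
  by rewrite /gauss_tangent; congr (expR _ * _); lra.
rewrite /gauss_tangent; set g := b - a in g0 g7 *.
have g1 : g <= 1 by rewrite /g; lra.
have h : expR (- (18 / 25)) <= 49 / 100 :> R.
  rewrite (_ : 18 / 25 = 2%:R * (9 / 25)); last by field.
  rewrite expRN expRM_natl -[leLHS]mul1r ler_pdivrMr ?exprn_gt0 ?expR_gt0//.
  by have := expR_ge_taylor5 (9 / 25 : R); rewrite /taylor5; nra.
have := expR_ge1Dx (- (2 * e ^+ 2)).
(* The right side is nonincreasing in [e] while [2 e <= g], and the left side is its value at
   [e = 7/20]. Likewise [151/200] below is [1 - 2 (7/20)^2]. *)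
have c : 149 / 100 - 7 / 5 * g <= 1 - 4 * e * (g - e) by nra.
move=> k.
apply: (@le_trans _ _ (49 / 100 * (61 / 25 - 12 / 5 * g))).
  by rewrite ler_wpM2r//; lra.
apply: (@le_trans _ _ (151 / 200 * (149 / 100 - 7 / 5 * g))); first by lra.
apply: ler_pM => //; first by lra.
by apply: le_trans k; nra.
Qed.

Lemma tilt_ge0 {R : realType} (e g : R) : 0 <= g -> 0 <= tilt e g.
Proof. by move=> g0; rewrite /tilt; do ![case: ifP => _]; lra. Qed.

Lemma tilt_le4 {R : realType} (e g : R) : g <= 1 -> tilt e g <= 4.
Proof. by move=> g0; rewrite /tilt; do ![case: ifP => _]; lra. Qed.

Lemma measurable_tilt {R : realType} (e : R) : measurable_fun setT (tilt e).
Proof.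
have c (x : R) (f h : R -> R) : measurable_fun setT f -> measurable_fun setT h ->
    measurable_fun setT (fun g : R => if g <= x then f g else h g).
  move=> mf mh; apply: measurable_fun_ifT => //.
  exact: measurable_fun_ler.
rewrite /tilt; case: (e <= _); repeat (apply: (@c) => //); exact: measurable_funM.
Qed.

(** The line is the tangent of the Gaussian at [d]. After integration only the mean of [g] matters,
    and [0 <= be] lets a lower bound [e] on that mean be used. For [d = 3/5] the second clause is
    [gauss_ratio_le1]. *)
Lemma affine_majorant {R : realType} (e : R) : 0 < e < 1 ->
  exists al be : R, [/\ 0 <= be, al - be * e <= expR (- (2 * e ^+ 2)) &
    forall a b : R, 0 <= a -> a <= b -> b <= 1 ->
      expR (- (tilt e (b - a) * b)) * (1 - a + a * expR (tilt e (b - a))) <=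
      al - be * (b - a)].
Proof.
move=> /andP[e0 e1].
pose d : R := if e <= 7 / 20 then e else 3 / 5.
have d0 : 0 <= d by rewrite /d; case: ifP => _; lra.
have dE g : gauss_tangent d g = expR (- (2 * d ^+ 2)) * (1 + 4 * d ^+ 2) -
    expR (- (2 * d ^+ 2)) * (4 * d) * g by rewrite /gauss_tangent; ring.
exists (expR (- (2 * d ^+ 2)) * (1 + 4 * d ^+ 2)),
  (expR (- (2 * d ^+ 2)) * (4 * d)); split.
- by rewrite !mulr_ge0 ?expR_ge0.
- rewrite -dE /d; case: ifPn => [_|].
    by rewrite /gauss_tangent subrr mulr0 subr0 mulr1.
  rewrite -ltNge => e7; rewrite gauss_tangentE -[leRHS]mulr1.
  by rewrite ler_wpM2l ?expR_ge0// gauss_ratio_le1// !ltW.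
- move=> a b a0 ab b1; rewrite -dE /d; case: ifPn => [e7|].
    by apply: bernoulli_mgf_tilt_small => //; rewrite e7 ltW.
  by rewrite -ltNge => e7; exact: bernoulli_mgf_tilt_large.
Qed.

(** * Bounded measurable functions *)

Section bounded_measurable_functions.
Context {R : realType} {d : measure_display} {T : measurableType d}.
Implicit Types (f g : T -> R) (nu : probability T R).

Definition bmf f := measurable_fun setT f /\ exists M : R, forall z, `|f z| <= M.

Lemma bmf_integrable nu f : bmf f -> nu.-integrable setT (EFin \o f).
Proof.
move=> [mf [M fM]]; apply: measurable_bounded_integrable => //.
  exact: le_lt_trans (probability_le1 nu measurableT) (ltry _).
exists M; split; first exact: num_real.
by move=> x Mx z _ /=; apply: le_trans (fM z) (ltW Mx).
Qed.

Lemma bmf_cst (r : R) : bmf (fun=> r).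
Proof. by split => //; exists `|r|. Qed.

Lemma bmfD f g : bmf f -> bmf g -> bmf (fun z => f z + g z).
Proof.
move=> [mf [M fM]] [mg [N gN]]; split; first exact: measurable_funD.
by exists (M + N) => z; apply: le_trans (ler_normD _ _) (lerD _ _).
Qed.

Lemma bmfM f g : bmf f -> bmf g -> bmf (fun z => f z * g z).
Proof.
move=> [mf [M fM]] [mg [N gN]]; split; first exact: measurable_funM.
by exists (M * N) => z; rewrite normrM ler_pM.
Qed.

Lemma bmfN f : bmf f -> bmf (fun z => - f z).
Proof.
move=> [mf [M fM]]; split; first exact: measurableT_comp.
by exists M => z; rewrite normrN.
Qed.

Lemma bmfB f g : bmf f -> bmf g -> bmf (fun z => f z - g z).
Proof. by move=> bf bg; exact: bmfD bf (bmfN bg). Qed.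

Lemma bmf_expR f : bmf f -> bmf (fun z => expR (f z)).
Proof.
move=> [mf [M fM]]; split; first exact: measurableT_comp.
exists (expR M) => z; rewrite ger0_norm ?expR_ge0// ler_expR.
exact: le_trans (ler_norm _) (fM z).
Qed.

Lemma bmf_indic (A : set T) : measurable A -> bmf (\1_A : T -> R).
Proof.
move=> mA; split; first exact: measurable_indic.
by exists 1 => z; rewrite indicE; case: (_ \in _); rewrite ?normr1 ?normr0.
Qed.

Lemma bmf_sum (I : Type) (s : seq I) (F : I -> T -> R) :
  (forall i, bmf (F i)) -> bmf (fun z => \sum_(i <- s) F i z).
Proof.
move=> bF; elim: s => [|i s IH].
  by under eq_fun do rewrite big_nil; exact: bmf_cst.
by under eq_fun do rewrite big_cons; exact: bmfD.
Qed.

Lemma Rintegral_prob_cst nu (r : R) : \int[nu]_z r = r.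
Proof.
rewrite Rintegral_cst// [X in fine X](probability_setT nu) ?mulr1//.
Qed.

Lemma bmf_RintegralD nu f g : bmf f -> bmf g ->
  \int[nu]_z (f z + g z) = \int[nu]_z f z + \int[nu]_z g z.
Proof. by move=> bf bg; rewrite RintegralD//; exact: bmf_integrable. Qed.

Lemma bmf_RintegralB nu f g : bmf f -> bmf g ->
  \int[nu]_z (f z - g z) = \int[nu]_z f z - \int[nu]_z g z.
Proof. by move=> bf bg; rewrite RintegralB//; exact: bmf_integrable. Qed.

Lemma bmf_RintegralZl nu (r : R) f : bmf f ->
  \int[nu]_z (r * f z) = r * \int[nu]_z f z.
Proof. by move=> bf; rewrite RintegralZl//; exact: bmf_integrable. Qed.

Lemma bmf_le_Rintegral nu f g : bmf f -> bmf g -> (forall z, f z <= g z) ->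
  \int[nu]_z f z <= \int[nu]_z g z.
Proof. by move=> bf bg fg; apply: le_Rintegral => //; exact: bmf_integrable. Qed.

Lemma bmf_Rintegral_sum nu (I : Type) (s : seq I) (F : I -> T -> R) :
  (forall i, bmf (F i)) ->
  \int[nu]_z (\sum_(i <- s) F i z) = \sum_(i <- s) \int[nu]_z F i z.
Proof.
move=> bF; elim: s => [|i s IH].
  under eq_fun do rewrite big_nil.
  by rewrite big_nil Rintegral_prob_cst.
under eq_fun do rewrite big_cons.
by rewrite bmf_RintegralD ?big_cons ?IH//; exact: bmf_sum.
Qed.

Lemma bmf_integralE nu f : bmf f ->
  (\int[nu]_z (f z)%:E)%E = (\int[nu]_z f z)%:E.
Proof.
by move=> bf; rewrite fineK//; apply: integrable_fin_num => //; exact: bmf_integrable.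
Qed.

Lemma Rintegral_indic nu (A : set T) : measurable A ->
  \int[nu]_z \1_A z = fine (nu A).
Proof. by move=> mA; rewrite /Rintegral integral_indic// setIT. Qed.

(** Simple functions are written [c \o J] with labels in a finite type, so integrals become finite
    sums and samples become words over [I]. *)
Definition fibers_measurable (I : finType) (J : T -> I) :=
  forall j, measurable (J @^-1` [set j]).

Section finite_range.
Context (I : finType) (J : T -> I) (mJ : fibers_measurable J).

Lemma finite_rangeE (c : I -> R) z :
  c (J z) = \sum_j c j * \1_(J @^-1` [set j]) z.
Proof.
rewrite (bigD1 (J z))//= big1 ?addr0 => [|j jJ].
  by rewrite indicE mem_set// mulr1.
rewrite indicE memNset ?mulr0//=.
by apply/eqP; rewrite eq_sym.
Qed.

Lemma bmf_finite_range (c : I -> R) : bmf (fun z => c (J z)).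
Proof.
under eq_fun do rewrite finite_rangeE.
by apply: bmf_sum => j; apply: bmfM; [exact: bmf_cst|exact: bmf_indic].
Qed.

Lemma Rintegral_finite_range nu (c : I -> R) :
  \int[nu]_z c (J z) = \sum_j c j * fine (nu (J @^-1` [set j])).
Proof.
under eq_fun do rewrite finite_rangeE.
rewrite bmf_Rintegral_sum => [|j]; last first.
  by apply: bmfM; [exact: bmf_cst|exact: bmf_indic].
apply: eq_bigr => j _.
by rewrite bmf_RintegralZl ?Rintegral_indic//; exact: bmf_indic.
Qed.

End finite_range.

(** Values are rounded up to a grid of step [e]; the shift by [M] makes them nonnegative, so that
    truncation is the integer part. *)
Lemma bmf_discretize f (e : R) : bmf f -> 0 < e ->
  exists (I : finType) (J : T -> I) (c : I -> R),
    fibers_measurable J /\ forall z, f z <= c (J z) <= f z + e.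
Proof.
move=> [mf [M fM]] e0.
pose h z : R := (f z + M) / e.
have h0 z : 0 <= h z.
  by rewrite divr_ge0 ?(ltW e0)//; have := fM z; rewrite ler_norml; lra.
pose K := Num.trunc (M * 2 / e).
have hK z : (Num.trunc (h z) < K.+1)%N.
  rewrite ltnS /K; apply: le_truncn; rewrite ler_pM2r ?invr_gt0//.
  by have := fM z; rewrite ler_norml; lra.
pose J z : 'I_K.+1 := Ordinal (hK z).
exists 'I_K.+1, J, (fun j : 'I_K.+1 => e * (j%:R + 1) - M); split.
  move=> j; have -> : J @^-1` [set j] = h @^-1` `[j%:R, j.+1%:R[.
    apply/seteqP; split => z /=; rewrite in_itv/=.
      by move=> <-/=; exact: truncn_itv.
    by rewrite -truncn_eq// => /eqP hj; exact/val_inj.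
  rewrite -[X in measurable X]setTI; apply: (_ : measurable_fun setT h) => //.
  by apply: measurable_funM => //; exact: measurable_funD.
move=> z /=; have /andP[] := truncn_itv (h0 z).
rewrite -addn1 natrD; set k := _%:R : R => kh hk.
have fE : f z = e * h z - M.
  by rewrite /h mulrCA divff ?gt_eqF// mulr1 addrK.
by rewrite fE; nra.
Qed.

End bounded_measurable_functions.

(** * Chernoff bounds for empirical measures *)

Lemma probability_bigsetU_le {R : realType} {d} {T : measurableType d}
  (P : probability T R) (I : Type) (s : seq I) (C : pred I) (E : I -> set T) :
  (forall i, measurable (E i)) ->
  (P (\big[setU/set0]_(i <- s | C i) E i) <= \sum_(i <- s | C i) P (E i))%E.
Proof.
move=> mE; elim: s => [|i s IH]; first by rewrite !big_nil measure0.
rewrite !big_cons; case: ifP => // _.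
apply: le_trans (measureU2 _ _ _) _ => //; first exact: bigsetU_measurable.
exact: leeD.
Qed.

Lemma outer_prob_le {R : realType} {d} {Om : measurableType d}
  (P : probability Om R) (E B : set Om) :
  measurable B -> E `<=` B -> (outer_prob P E <= P B)%E.
Proof. by move=> mB EB; apply: ereal_inf_lbound; exists B. Qed.

Section chernoff.
Context {R : realType} {d dO : measure_display} {T : measurableType d}
  {Om : measurableType dO} (P : probability Om R) (Q : probability T R)
  (Z : nat -> Om -> T) (L : nat -> Om -> probability T R).
Hypotheses (hZ : iid_seq P Z Q) (hL : empirical Z L).

Section finite_range.
Context (I : finType) (J : T -> I) (mJ : fibers_measurable J).

Lemma iid_cylinder n (s : {ffun 'I_n -> I}) :
  exists2 E : set Om, measurable E &
    (forall w, (forall i : 'I_n, J (Z i w) = s i) -> E w) /\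
    P E = (\prod_(i < n) fine (Q (J @^-1` [set s i])))%:E.
Proof.
have [mZ [lawZ indZ]] := hZ.
(* Independence is stated for families indexed by all of [nat], so the cylinder is padded with
   [setT] beyond [n]. *)
pose A (i : nat) : set T :=
  if insub i is Some j then J @^-1` [set s j] else setT.
have mA i : measurable (A i).
  by rewrite /A; case: insubP => [j _ _|_] //; exact: mJ.
exists (\bigcap_(i in [set i | i \in iota 0 n]) Z i @^-1` A i).
  apply: bigcap_measurableType; by move=> i _; rewrite -[X in measurable X]setTI; exact: mZ.
split.
  move=> w Jw i _; rewrite /= /A; case: insubP => [j _ ij|_] //=.
  by rewrite -ij; exact: Jw.
rewrite indZ ?iota_uniq// -{1}[n]subn0 -/(index_iota 0 n).
rewrite big_mkord -prodEFin; apply: eq_bigr => i _.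
rewrite lawZ// fineK ?fin_num_measure//; congr (Q _).
by rewrite /A valK.
Qed.

Lemma empirical_mean n (c : I -> R) w : (0 < n)%N ->
  \int[L n w]_z c (J z) = n%:R^-1 * \sum_(i < n) c (J (Z i w)).
Proof.
move=> n0; rewrite Rintegral_finite_range//.
under eq_bigr do rewrite hL//= mulrCA mulr_sumr.
rewrite -mulr_sumr exchange_big/=; congr (_ * _).
by apply: eq_bigr => i _; rewrite (finite_rangeE J c).
Qed.

(** Independence is available for events only, so Markov's inequality is carried out on words: the
    event is covered by the cylinders of the words [s] with [sum_i c (s i) >= n r]. Each is weighted
    by [e^(sum_i c (s i) - n r) >= 1], and the sum over all words factors into an [n]-th power. *)
Lemma chernoff_finite_range n (c : I -> R) (r : R) : (0 < n)%N ->
  (outer_prob P [set w | r <= \int[L n w]_z c (J z)]%R <=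
   ((expR (- r) * \int[Q]_z expR (c (J z))) ^+ n)%:E)%E.
Proof.
move=> n0.
pose E s := sval (cid2 (@iid_cylinder n s)).
have mE s : measurable (E s) by rewrite /E; case: cid2.
have EP (s : {ffun 'I_n -> I}) : (forall w, (forall i : 'I_n, J (Z i w) = s i) -> E s w) /\
    P (E s) = (\prod_(i < n) fine (Q (J @^-1` [set s i])))%:E.
  by rewrite /E; case: cid2.
pose C (s : {ffun 'I_n -> I}) := n%:R * r <= \sum_(i < n) c (s i).
have nR : 0 < n%:R :> R by rewrite ltr0n.
apply: (@le_trans _ _ (P (\big[setU/set0]_(s | C s) E s))).
  apply: outer_prob_le; first exact: bigsetU_measurable.
  move=> w /=; rewrite empirical_mean// ler_pdivlMl// => rw.
  pose s := [ffun i : 'I_n => J (Z i w)].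
  rewrite (bigD1 s)/=; last first.
    by rewrite /C; under eq_bigr do rewrite ffunE.
  by left; apply: (EP s).1 => i; rewrite ffunE.
apply: le_trans (probability_bigsetU_le _ _ _ mE) _.
under eq_bigr do rewrite (EP _).2.
rewrite sumEFin lee_fin exprMn -expRM_natl mulrN.
rewrite (Rintegral_finite_range mJ Q (fun j => expR (c j))).
rewrite -[X in _ * _ ^+ X]card_ord -prodr_const bigA_distr_bigA/= mulr_sumr.
rewrite big_mkcond/=; apply: ler_sum => s _.
rewrite big_split/= -expR_sum mulrA -expRD.
have p0 : 0 <= \prod_(i < n) fine (Q (J @^-1` [set s i])).
  by apply: prodr_ge0 => i _; exact: fine_ge0.
case: ifPn => [Cs|_]; last by rewrite mulr_ge0 ?expR_ge0.
by rewrite ler_peMl// -[leLHS]expR0 ler_expR addrC subr_ge0.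
Qed.

End finite_range.

(** The slack [e] is the price of replacing [f] by a simple function above it. *)
Lemma chernoff n (f : T -> R) (r e : R) : (0 < n)%N -> bmf f -> 0 < e ->
  (outer_prob P [set w | r <= \int[L n w]_z f z]%R <=
   ((expR (e - r) * \int[Q]_z expR (f z)) ^+ n)%:E)%E.
Proof.
move=> n0 bf e0; have [I [J [c [mJ fc]]]] := bmf_discretize bf e0.
have bc := bmf_finite_range mJ c.
apply: (@le_trans _ _ (outer_prob P [set w | r <= \int[L n w]_z c (J z)]%R)).
  apply: ereal_inf_le_tmp => _ [B [mB EB] <-]; exists B => //; split => //.
  move=> w rw; apply: EB => /=; apply: le_trans rw _.
  by apply: bmf_le_Rintegral => // z; have /andP[] := fc z.
apply: le_trans (chernoff_finite_range mJ _ _ n0) _.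
have i0 g : 0 <= \int[Q]_z expR (g z).
  by apply: Rintegral_ge0 => z _; exact: expR_ge0.
rewrite lee_fin; apply: lerXn2r; rewrite ?nnegrE ?mulr_ge0 ?expR_ge0//.
rewrite addrC expRD -mulrA ler_wpM2l ?expR_ge0// -bmf_RintegralZl; last exact: bmf_expR.
apply: bmf_le_Rintegral; [exact: bmf_expR| |].
  by apply: bmfM; [exact: bmf_cst|exact: bmf_expR].
by move=> z; rewrite -expRD ler_expR addrC; have /andP[] := fc z.
Qed.

End chernoff.

(** * Thin sets and ultrafilter limits *)

(** Compactness of [[a, b]] provides a cluster point, and along an ultrafilter a cluster point is a
    limit. *)
Lemma ultra_bounded_cvg {R : realType} (U : Type) (G : set_system U)
  (uG : UltraFilter G) (h : U -> R) (a b : R) : (forall u, a <= h u <= b) ->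
  exists l : R, h u @[u --> G] --> l.
Proof.
move=> hab.
have hG : G (h @^-1` `[a, b]%classic).
  by apply: filterE => u; rewrite /= in_itv /= hab.
have [l [_ cl]] := @segment_compact R a b (h @ G) _ hG.
exists l; move=> V Vl.
have [//|GV] := in_ultra_setVsetC (h @^-1` V) uG.
have [x [nVx Vx]] := cl (~` V) V GV Vl.
by have := nVx Vx.
Qed.

Section probability_of_set_function.
Context {R : realType} {d} {T : measurableType d} (m : set T -> \bar R).
Hypotheses (m0 : m set0 = 0%E) (m_ge0 : forall A, (0 <= m A)%E)
  (m_sigma : semi_sigma_additive m) (m1 : m setT = 1%E).

Let mu := m.

HB.instance Definition _ := isMeasure.Build d T R mu m0 m_ge0 m_sigma.

HB.instance Definition _ := Measure_isProbability.Build d T R mu m1.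

Lemma probability_of_set_function :
  exists nu : probability T R, forall A, nu A = m A.
Proof. by exists (mu : probability T R). Qed.

End probability_of_set_function.

Section thin.
Context {R : realType} {d dO : measure_display} {T : measurableType d}
  {Om : measurableType dO} (P : probability Om R)
  (L : nat -> Om -> probability T R) (c : R).
Implicit Types S : set (probability T R).

Definition thin S := exists C : R, forall n, (0 < n)%N ->
  (outer_prob P [set w | S (L n w)] <= (C * expR (- c) ^+ n)%:E)%E.

Lemma outer_prob_ge0 (E : set Om) : (0 <= outer_prob P E)%E.
Proof. by apply: le_ereal_inf_tmp => _ [B [mB EB] <-]. Qed.

Lemma outer_probS (E E' : set Om) : E `<=` E' -> (outer_prob P E <= outer_prob P E')%E.
Proof.
move=> EE'; apply: ereal_inf_le_tmp => _ [B [mB EB] <-]; exists B => //; split => //.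
exact: subset_trans EE' EB.
Qed.

Lemma outer_probU (E E' : set Om) :
  (outer_prob P (E `|` E') <= outer_prob P E + outer_prob P E')%E.
Proof.
have [->|] := eqVneq (outer_prob P E) +oo%E.
  by rewrite addye ?leey// gt_eqF// (lt_le_trans _ (outer_prob_ge0 _)).
rewrite -ltey => Ey; have [->|] := eqVneq (outer_prob P E') +oo%E.
  by rewrite addey ?leey// gt_eqF// (lt_le_trans _ (outer_prob_ge0 _)).
rewrite -ltey => E'y.
have fE : outer_prob P E \is a fin_num by rewrite ge0_fin_numE ?outer_prob_ge0.
have fE' : outer_prob P E' \is a fin_num by rewrite ge0_fin_numE ?outer_prob_ge0.
apply/lee_addgt0Pr => e e0; rewrite (splitr e) EFinD addeACA.
have e20 : 0 < e / 2 by rewrite divr_gt0.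
have [_ [B [mB EB] <-] hB] := lb_ereal_inf_adherent e20 fE.
have [_ [B' [mB' EB'] <-] hB'] := lb_ereal_inf_adherent e20 fE'.
apply: (@le_trans _ _ (P (B `|` B'))).
  by apply: outer_prob_le; [exact: measurableU|exact: setUSS].
apply: le_trans (measureU2 _ mB mB') _.
by apply: leeD; exact: ltW.
Qed.

Lemma thinS S S' : S `<=` S' -> thin S' -> thin S.
Proof.
move=> SS' [C hC]; exists C => n n0; apply: le_trans (hC n n0).
by apply: outer_probS => w; exact: SS'.
Qed.

Lemma thinU S S' : thin S -> thin S' -> thin (S `|` S').
Proof.
move=> [C hC] [C' hC']; exists (C + C') => n n0.
rewrite mulrDl EFinD; apply: le_trans (leeD (hC n n0) (hC' n n0)).
exact: outer_probU.
Qed.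

Lemma thin0 : thin set0.
Proof.
exists 0 => n _; rewrite mul0r.
by apply: le_trans (@outer_prob_le _ _ _ P _ set0 measurable0 _) _; rewrite ?measure0.
Qed.

(* The sets with thin relative complement form a filter, proper as soon as [S]
   is not thin. *)
Lemma not_thin_ultrafilter S : ~ thin S ->
  exists2 G : set_system (probability T R), UltraFilter G &
    G S /\ forall S', thin S' -> G (~` S').
Proof.
move=> nS; pose H : set_system (probability T R) := [set A | thin (S `\` A)].
have HF : ProperFilter H.
  split; first by rewrite /H/= setD0.
  split; first by rewrite /H/= setDT; exact: thin0.
    by move=> A B HA HB; rewrite /H/= setDIr; exact: thinU.
  by move=> A B AB; apply: thinS => x [Sx nBx]; split=> // /AB.
have [G [uG HG]] := ultraFilterLemma HF; exists G => //; split.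
  by apply: HG; rewrite /H/= setDv; exact: thin0.
by move=> S' tS'; apply: HG; rewrite /H/= setDE setCK; apply: thinS tS' => x [].
Qed.

Lemma thin_halfspace (Q : probability T R) (Z : nat -> Om -> T)
  (f : T -> R) (r e : R) : iid_seq P Z Q -> empirical Z L -> bmf f -> 0 < e ->
  \int[Q]_z expR (f z) <= expR (r - e - c) ->
  thin [set nu : probability T R | r <= \int[nu]_z f z].
Proof.
move=> hZ hL bf e0 hr; exists 1 => n n0; rewrite mul1r.
apply: le_trans (chernoff hZ hL r n0 bf e0) _.
rewrite lee_fin; apply: lerXn2r; rewrite ?nnegrE ?expR_ge0//.
  by rewrite mulr_ge0 ?expR_ge0// Rintegral_ge0// => z _; exact: expR_ge0.
apply: (@le_trans _ _ (expR (e - r) * expR (r - e - c))).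
  by rewrite ler_wpM2l ?expR_ge0.
by rewrite -expRD ler_expR; lra.
Qed.

End thin.

(** * Countable additivity of set-wise ultrafilter limits *)

Section ultralimit.
Context {R : realType} {d : measure_display} {T : measurableType d}
  (G : set_system (probability T R)) (uG : UltraFilter G)
  (Q : probability T R) (c : R).
Hypothesis exp_bound : forall (f : T -> R) (r e : R), bmf f -> 0 < e ->
  \int[Q]_z expR (f z) <= expR (r - e - c) ->
  G [set nu : probability T R | \int[nu]_z f z < r].

(* Truncated at [1] so that the limit also exists at nonmeasurable sets. *)
Definition ulim (A : set T) : R :=
  lim ((fun nu : probability T R => Num.min 1 (fine (nu A))) @ G).

Lemma cvg_ulim_min A : (fun nu : probability T R => Num.min 1 (fine (nu A))) @ G --> ulim A.
Proof.
have [nu|l hl] := @ultra_bounded_cvg R _ G uG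
  (fun nu : probability T R => Num.min 1 (fine (nu A))) 0 1.
  by rewrite le_min ler01 fine_ge0//= ge_min lexx.
by apply/cvg_ex; exists l.
Qed.

Lemma cvg_ulim A : measurable A ->
  (fun nu : probability T R => fine (nu A)) @ G --> ulim A.
Proof.
move=> mA; rewrite [X in X @ G](_ : _ = fun nu : probability T R => Num.min 1 (fine (nu A))).
  exact: cvg_ulim_min.
apply/funext => nu; apply/esym/min_idPr.
by rewrite -lee_fin fineK ?fin_num_measure// probability_le1.
Qed.

Lemma ulim_ge0 A : 0 <= ulim A.
Proof.
apply: cvgr_to_ge (@cvg_ulim_min A) _.
by apply: filterE => nu /=; rewrite le_min ler01 fine_ge0.
Qed.

Lemma ulim0 : ulim set0 = 0.
Proof.
apply: cvg_lim => //; under eq_fun do rewrite measure0/= min_r//.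
exact: cvg_cst.
Qed.

Lemma ulimT : ulim setT = 1.
Proof.
apply: (cvg_unique (@norm_hausdorff _ _) (cvg_ulim measurableT)).
rewrite [X in X @ G](_ : _ = fun=> 1); first exact: cvg_cst.
by apply/funext => nu; rewrite [X in fine X](probability_setT nu).
Qed.

(** Apply [exp_bound] to [t 1_A]: if [Q A <= e^(- t)] then [E e^(t 1_A) <= 1 + e^t Q A <= 2 <= e],
    where the last [e] is Euler's number, so that [t * ulim A <= c + 2]; then [t] is taken large. *)
Lemma ulim_abscont (e : R) : 0 < e -> exists2 h : R, 0 < h &
  forall A, measurable A -> fine (Q A) <= h -> ulim A <= e.
Proof.
move=> e0; pose t := (`|c| + 2) / e.
have t0 : 0 < t by rewrite divr_gt0// ltr_wpDl.
exists (expR (- t)); first exact: expR_gt0.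
move=> A mA QA.
have bA : bmf (\1_A : T -> R) := bmf_indic mA.
have GA : G [set nu : probability T R | \int[nu]_z (t * \1_A z) < c + 2].
  apply: (@exp_bound _ _ 1) => //; first exact/bmfM/bA/bmf_cst.
  rewrite (_ : c + 2 - 1 - c = 1); last by ring.
  apply: (@le_trans _ _ (\int[Q]_z (1 + expR t * \1_A z))).
    apply: bmf_le_Rintegral.
    - exact/bmf_expR/bmfM/bA/bmf_cst.
    - exact/bmfD/bmfM/bA/bmf_cst/bmf_cst.
    move=> z; rewrite indicE; case: (_ \in _); rewrite ?(mulr1, mulr0).
      by rewrite lerDr.
    by rewrite expR0 addr0.
  rewrite bmf_RintegralD; [|exact: bmf_cst|exact/bmfM/bA/bmf_cst].
  rewrite Rintegral_prob_cst bmf_RintegralZl// Rintegral_indic//.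
  apply: le_trans (expR_ge1Dx 1); rewrite lerD2l.
  by rewrite -(@ler_pM2l _ (expR (- t))) ?expR_gt0// mulrA -expRD addNr expR0 mul1r mulr1.
apply: cvgr_to_le (cvg_ulim mA) _.
apply: filterS GA => nu /=; rewrite bmf_RintegralZl// Rintegral_indic// => h.
rewrite -(ler_pM2l t0); apply: le_trans (ltW h) _.
by rewrite /t divfK ?gt_eqF// lerD2r ler_norm.
Qed.

Lemma cvg_ulim_sum (F : nat -> set T) n : (forall i, measurable (F i)) ->
  (fun nu : probability T R => \sum_(i < n) fine (nu (F i))) @ G -->
  \sum_(i < n) ulim (F i).
Proof.
move=> mF; elim: n => [|n IH].
  under eq_fun do rewrite big_ord0.
  by rewrite big_ord0; exact: cvg_cst.
under eq_fun do rewrite big_ord_recr/=.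
by rewrite big_ord_recr/=; apply: cvgD => //; exact: cvg_ulim.
Qed.

Lemma fine_measure_tail (nu : probability T R) (F : nat -> set T) n :
  (forall i, measurable (F i)) -> trivIset setT F -> measurable (\bigcup_k F k) ->
  fine (nu (\bigcup_k F k `\` \big[setU/set0]_(i < n) F i)) =
  fine (nu (\bigcup_k F k)) - \sum_(i < n) fine (nu (F i)).
Proof.
move=> mF tF mU.
have mB : measurable (\big[setU/set0]_(i < n) F i) by exact: bigsetU_measurable.
have BU : \big[setU/set0]_(i < n) F i `<=` \bigcup_k F k.
  by rewrite -bigcup_mkord => x [i _ Fx]; exists i.
rewrite measureD//; last by rewrite -ge0_fin_numE ?fin_num_measure.
rewrite setIidr// fineB ?fin_num_measure//; congr (_ - _).
by rewrite measure_bigsetU// sum_fine// => i _; exact: fin_num_measure.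
Qed.

(** Finite additivity passes to the limit, so the error of the partial sums is [ulim] of the tail
    [D n]. The [Q]-mass of the tail tends to [0], and [ulim_abscont] transfers this to [ulim]. *)
Lemma ulim_sigma_additive : semi_sigma_additive (fun A => (ulim A)%:E).
Proof.
move=> F mF tF mU; set U := \bigcup_k F k.
pose D n := U `\` \big[setU/set0]_(i < n) F i.
have mD n : measurable (D n).
  by apply: measurableD => //; exact: bigsetU_measurable.
have DE n : ulim (D n) = ulim U - \sum_(i < n) ulim (F i).
  apply: (cvg_unique (@norm_hausdorff _ _) (cvg_ulim (mD n))).
  rewrite [X in X @ G](_ : _ = fun nu : probability T R =>
    fine (nu U) - \sum_(i < n) fine (nu (F i))).
    by apply: cvgB; [exact: cvg_ulim|exact: cvg_ulim_sum].
  by apply/funext => nu; exact: fine_measure_tail.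
have QS : \sum_(i < n) fine (Q (F i)) @[n --> \oo] --> fine (Q U).
  have := @measure_semi_sigma_additive _ _ _ Q F mF tF mU; rewrite -/U.
  rewrite -[X in _ --> X](@fineK _ (Q U)) ?fin_num_measure// => /fine_cvg.
  rewrite [X in X @ \oo](_ : _ = fun n => \sum_(i < n) fine (Q (F i)))//.
  apply/funext => n /=; rewrite big_mkord sum_fine// => i _.
  exact: fin_num_measure.
under eq_fun do rewrite sumEFin big_mkord.
apply: cvg_EFin; first by apply: nearW.
apply/cvgrPdist_le => e e0.
have [h h0 he] := ulim_abscont e0.
have /cvgrPdist_le/(_ h h0) := QS.
apply: filterS => n hn.
rewrite -DE ger0_norm ?ulim_ge0//; apply: he => //.
rewrite fine_measure_tail//; exact: le_trans (ler_norm _) hn.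
Qed.

Lemma ulim_probability :
  exists nu : probability T R, forall A, nu A = (ulim A)%:E.
Proof.
apply: probability_of_set_function.
- by rewrite ulim0.
- by move=> A; rewrite lee_fin ulim_ge0.
- exact: ulim_sigma_additive.
- by rewrite ulimT.
Qed.

End ultralimit.

(** A simple function within [e / 3] of [f] changes the integral by at most [e / 3] under every
    probability, and its integrals converge as finite sums. *)
Lemma ultra_Rintegral_close {R : realType} {d} {T : measurableType d}
  (G : set_system (probability T R)) (uG : UltraFilter G) (nu : probability T R) :
  (forall A, measurable A ->
    (fun mu : probability T R => fine (mu A)) @ G --> fine (nu A)) ->
  forall (f : T -> R) (e : R), bmf f -> 0 < e ->
  G [set mu : probability T R | `|\int[mu]_z f z - \int[nu]_z f z| < e].
Proof.
move=> hG f e bf e0.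
have e30 : 0 < e / 3 by rewrite divr_gt0.
have [I [J [c [mJ fc]]]] := bmf_discretize bf e30.
have bc := bmf_finite_range mJ c.
have close (mu : probability T R) :
    \int[mu]_z f z <= \int[mu]_z c (J z) <= \int[mu]_z f z + e / 3.
  rewrite bmf_le_Rintegral//=; last by move=> z; have /andP[] := fc z.
  rewrite -[leRHS](_ : \int[mu]_z (f z + e / 3) = _); last first.
    by rewrite bmf_RintegralD ?Rintegral_prob_cst//; exact: bmf_cst.
  apply: bmf_le_Rintegral => //; first exact/bmfD/bmf_cst.
  by move=> z; have /andP[] := fc z.
have cvgc : (fun mu : probability T R => \int[mu]_z c (J z)) @ G -->
    \int[nu]_z c (J z).
  rewrite Rintegral_finite_range// [X in X @ G](_ : _ =
    fun mu : probability T R => \sum_j c j * fine (mu (J @^-1` [set j]))).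
    have cs (s : seq I) :
        (fun mu : probability T R => \sum_(j <- s) c j * fine (mu (J @^-1` [set j])))
        @ G --> \sum_(j <- s) c j * fine (nu (J @^-1` [set j])).
      elim: s => [|j s IH].
        under eq_fun do rewrite big_nil.
        by rewrite big_nil; exact: cvg_cst.
      under eq_fun do rewrite big_cons.
      by rewrite big_cons; apply: cvgD => //; apply: cvgMr; exact: hG.
    exact: cs.
  by apply/funext => mu; rewrite Rintegral_finite_range.
move/cvgrPdist_lt : cvgc => /(_ _ e30); apply: filterS => mu /=.
have /andP[] := close mu; have /andP[] := close nu.
by rewrite !ltr_norml; lra.
Qed.

(* The half of Sanov's theorem in the tau-topology needed for an upper bound:
   [nu] is a tau-limit point of [S] and, by the Donsker-Varadhan formula, the
   second clause says that the relative entropy of [nu] given [Q] is at most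
   [c]. *)
Lemma not_thin_limit {R : realType} {d dO} {T : measurableType d}
  {Om : measurableType dO} (P : probability Om R) (Q : probability T R)
  (Z : nat -> Om -> T) (L : nat -> Om -> probability T R) (c : R)
  (S : set (probability T R)) :
  iid_seq P Z Q -> empirical Z L -> ~ thin P L c S ->
  exists nu : probability T R,
    (forall k (f : 'I_k -> T -> R) (e : 'I_k -> R),
       (forall i, bmf (f i)) -> (forall i, 0 < e i) ->
       exists2 mu : probability T R, S mu &
         forall i, `|\int[mu]_z f i z - \int[nu]_z f i z| < e i) /\
    (forall f, bmf f -> expR (\int[nu]_z f z - c) <= \int[Q]_z expR (f z)).
Proof.
move=> hZ hL nS; have [G uG [GS Gthin]] := not_thin_ultrafilter nS.
have Gexp (f : T -> R) (r e : R) : bmf f -> 0 < e ->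
    \int[Q]_z expR (f z) <= expR (r - e - c) ->
    G [set nu : probability T R | \int[nu]_z f z < r].
  move=> bf e0 hr; have := Gthin _ (thin_halfspace hZ hL bf e0 hr).
  by apply: filterS => nu /= /negP; rewrite -ltNge.
have [nu nuE] := ulim_probability uG Gexp.
have Gnu A : measurable A ->
    (fun mu : probability T R => fine (mu A)) @ G --> fine (nu A).
  by move=> mA; rewrite nuE; exact: cvg_ulim.
have Gf := ultra_Rintegral_close uG Gnu.
exists nu; split.
  move=> k f e bf e0.
  have Gall : \forall mu \near G,
      forall i, `|\int[(mu : probability T R)]_z f i z - \int[nu]_z f i z| < e i.
    by apply: filter_forall => i; exact: Gf.
  have [mu [Smu hmu]] := filter_ex (filterI GS Gall).
  by exists mu.
move=> f bf; have [_ [M fM]] := bf.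
rewrite leNgt; apply/negP => lt.
set I := \int[Q]_z expR (f z) in lt; set x := \int[nu]_z f z in lt.
have I0 : 0 < I.
  apply: (@lt_le_trans _ _ (expR (- M))); first exact: expR_gt0.
  rewrite -(Rintegral_prob_cst Q (expR (- M))); apply: bmf_le_Rintegral.
  - exact: bmf_cst.
  - exact: bmf_expR.
  by move=> z; rewrite ler_expR; have := fM z; rewrite ler_norml => /andP[].
(* Half of the gap: [exp_bound] then puts [G] on integrals below [x - e], against their convergence
   to [x]. *)
pose e := (x - c - ln I) / 2.
have e0 : 0 < e by rewrite divr_gt0// subr_gt0 -ltr_expR lnK.
have h1 : G [set mu : probability T R | \int[mu]_z f z < x - e].
  apply: (Gexp f (x - e) e) => //.
  rewrite (_ : x - e - e - c = ln I) ?lnK//; rewrite /e; lra.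
have [mu []] := filter_ex (filterI h1 (Gf f e bf e0)).
by rewrite /= ltr_norml -/x; lra.
Qed.

(** * The test function *)

Section finite_conditionals.
Context {R : realType} {Y : pointedType} (finY : finite_set [set: Y]).
Implicit Types p q k : Y -> R.

Let sumY (F : Y -> R) : \sum_(y \in [set: Y]) F y = \sum_(y <- fset_set [set: Y]) F y.
Proof. exact: fsbig_finite. Qed.

(** The mass that [k] gives to [A = {y | p y < q y}]; thus [a] and [b] of the overview are the cases
    [k = p] and [k = q]. *)
Definition upper_mass (p q k : Y -> R) : R :=
  \sum_(y <- fset_set [set: Y]) (p y < q y)%R%:R * k y.

Lemma tvE p q : tv p q = 2^-1 * \sum_(y <- fset_set [set: Y]) `|p y - q y|.
Proof. by rewrite /tv sumY. Qed.

Lemma tv_sym p q : tv p q = tv q p.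
Proof. by rewrite !tvE; congr (_ * _); apply: eq_bigr => y _; rewrite distrC. Qed.

Lemma tv_ge0 p q : 0 <= tv p q.
Proof. by rewrite tvE mulr_ge0 ?invr_ge0// sumr_ge0. Qed.

Lemma tv_triangle p q k : tv p q <= tv p k + tv k q.
Proof.
rewrite !tvE -mulrDr ler_wpM2l ?invr_ge0// -big_split/= ler_sum// => y _.
exact: ler_distD.
Qed.

Lemma tv_le1 p q : (forall y, 0 <= p y) -> (forall y, 0 <= q y) ->
  \sum_(y \in [set: Y]) p y = 1 -> \sum_(y \in [set: Y]) q y = 1 -> tv p q <= 1.
Proof.
rewrite !sumY tvE => p0 q0 p1 q1.
rewrite ler_pdivrMl// mulr1 -[2]/(1 + 1) -{1}p1 -q1 -big_split/= ler_sum// => y _.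
by rewrite (le_trans (ler_normB _ _))// !ger0_norm.
Qed.

(** The set where [p < q] attains the total variation: adding the null sum of [q - p] to that of
    [|p - q|] doubles the positive part of [q - p]. *)
Lemma upper_massB p q : \sum_(y \in [set: Y]) p y = \sum_(y \in [set: Y]) q y ->
  upper_mass p q q - upper_mass p q p = tv p q.
Proof.
rewrite !sumY tvE /upper_mass => pq.
have s0 : \sum_(y <- fset_set [set: Y]) (q y - p y) = 0 by rewrite sumrB pq subrr.
rewrite -sumrB; apply: (@mulfI _ 2) => //; rewrite mulrA divff// mul1r.
transitivity (\sum_(y <- fset_set [set: Y]) `|p y - q y| +
  \sum_(y <- fset_set [set: Y]) (q y - p y)); last by rewrite s0 addr0.
rewrite mulr_sumr -big_split/=; apply: eq_bigr => y _.
by case: ltP => h; [rewrite ltr0_norm ?subr_lt0|rewrite ger0_norm ?subr_ge0];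
  rewrite ?mul1r ?mul0r//; lra.
Qed.

Lemma upper_mass_tv p q k : \sum_(y \in [set: Y]) k y = \sum_(y \in [set: Y]) q y ->
  upper_mass p q q - tv k q <= upper_mass p q k.
Proof.
rewrite !sumY tvE /upper_mass => kq.
have s0 : \sum_(y <- fset_set [set: Y]) (q y - k y) = 0 by rewrite sumrB kq subrr.
rewrite lerBlDr -lerBlDl -sumrB -(@ler_pM2l _ 2)// mulrA divff// mul1r.
apply: (@le_trans _ _ (\sum_(y <- fset_set [set: Y]) `|k y - q y| +
  \sum_(y <- fset_set [set: Y]) (q y - k y))); last by rewrite s0 addr0.
rewrite mulr_sumr -big_split/= ler_sum// => y _.
by have := ler_norm (k y - q y); have := ler_norm (q y - k y);
  rewrite (distrC (q y)); case: (_ < _); rewrite ?mul1r ?mul0r; lra.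
Qed.

Lemma upper_mass_ge0 p q k : (forall y, 0 <= k y) -> 0 <= upper_mass p q k.
Proof. by move=> k0; apply: sumr_ge0 => y _; rewrite mulr_ge0. Qed.

Lemma upper_mass_le1 p q k : (forall y, 0 <= k y) ->
  \sum_(y \in [set: Y]) k y = 1 -> upper_mass p q k <= 1.
Proof.
by rewrite sumY => k0 <-; apply: ler_sum => y _; case: (_ < _); rewrite ?mul1r ?mul0r.
Qed.

Lemma sum_expR_upper p q l b : \sum_(y \in [set: Y]) p y = 1 ->
  \sum_(y <- fset_set [set: Y]) expR (l * ((p y < q y)%R%:R - b)) * p y =
  expR (- (l * b)) * (1 - upper_mass p q p + upper_mass p q p * expR l).
Proof.
rewrite sumY => p1.
have -> : 1 - upper_mass p q p =
    \sum_(y <- fset_set [set: Y]) (p y - (p y < q y)%R%:R * p y).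
  by rewrite sumrB p1.
rewrite /upper_mass mulr_suml -big_split/= mulr_sumr; apply: eq_bigr => y _.
case: (_ < _) => /=; rewrite ?mulr1n ?mulr0n mulrBr ?mulr1 ?mulr0 ?sub0r ?expRD.
  by ring.
by ring.
Qed.

Lemma sum_upper_centered p q k l b : \sum_(y \in [set: Y]) k y = 1 ->
  \sum_(y <- fset_set [set: Y]) l * ((p y < q y)%R%:R - b) * k y =
  l * (upper_mass p q k - b).
Proof.
rewrite sumY => k1.
have -> : upper_mass p q k - b =
    \sum_(y <- fset_set [set: Y]) ((p y < q y)%R%:R * k y - b * k y).
  by rewrite sumrB -mulr_sumr k1 mulr1.
by rewrite mulr_sumr; apply: eq_bigr => y _; ring.
Qed.

End finite_conditionals.

(** * Integration through a disintegration *)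

Section disintegration.
Context {R : realType} {X : completePseudoMetricType R} {Y : pointedType}
  (finY : finite_set [set: Y]).
Implicit Types (nu : probability (XYT X Y) R) (k : X -> Y -> R).

Lemma bmf_fst (h : borelT X -> R) : bmf h -> bmf (fun z : XYT X Y => h z.1).
Proof.
move=> [mh [M hM]]; split; last by exists M => z; exact: hM.
exact: (measurableT_comp mh measurable_fst).
Qed.

Lemma bmf_indic_snd (y : Y) : bmf (fun z : XYT X Y => \1_[set y] z.2 : R).
Proof.
split; last by exists 1 => z; rewrite indicE; case: (_ \in _); rewrite ?normr1 ?normr0.
have my : measurable ([set y] : set (powT Y)) by exact: sub_sigma_algebra.
exact: (measurableT_comp (measurable_indic my) measurable_snd).
Qed.

Lemma simplex_le1 k x y : simplex_map k -> k x y <= 1.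
Proof.
move=> [k0 [k1 _]]; rewrite -(k1 x) fsbig_finite//=.
rewrite (big_fsetD1 y)/=; last by rewrite in_fset_set// in_setT.
by rewrite lerDl sumr_ge0.
Qed.

Lemma bmf_simplex k y : simplex_map k -> bmf (fun x : borelT X => k x y).
Proof.
move=> sk; split; first exact: sk.2.2.
by exists 1 => x; rewrite ger0_norm ?simplex_le1//; exact: sk.1.
Qed.

(** The definition gives [h = 1_A] only, that is, [D = 1_(y) - k] integrates to [0] over each [A].
    This extends to simple [h] by linearity and to bounded [h] by uniform approximation, as
    [|D| <= 1]. *)
Lemma disintegration_slice nu k (h : borelT X -> R) (y : Y) :
  disintegration nu k -> bmf h ->
  \int[nu]_z (h z.1 * \1_[set y] z.2) = \int[nu]_z (h z.1 * k z.1 y).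
Proof.
move=> [sk dk] bh.
have bky := bmf_fst (bmf_simplex y sk); have biy := bmf_indic_snd y.
pose D (z : XYT X Y) : R := \1_[set y] z.2 - k z.1 y.
have bD : bmf D by exact: bmfB.
have D1 z : `|D z| <= 1.
  rewrite /D indicE; have k1 := simplex_le1 z.1 y sk; have k0 := sk.1 z.1 y.
  by case: (_ \in _) => /=; rewrite ler_norml; lra.
have DA (A : set (borelT X)) : measurable A -> \int[nu]_z (\1_A z.1 * D z) = 0.
  move=> mA.
  have mAy : measurable (A `*` [set y] : set (XYT X Y)).
    by apply: measurableX => //; exact: sub_sigma_algebra.
  have mAT : measurable (A `*` [set: powT Y] : set (XYT X Y)) by exact: measurableX.
  have bA := bmf_fst (bmf_indic mA).
  rewrite /D; under eq_Rintegral do rewrite mulrBr.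
  rewrite bmf_RintegralB; [|exact: bmfM|exact: bmfM].
  apply/eqP; rewrite subr_eq0; apply/eqP.
  transitivity (fine (nu (A `*` [set y]))).
    rewrite -Rintegral_indic//; apply: eq_Rintegral => -[x y'] _ /=.
    by rewrite !indicE in_setX/= -natrM mulnb.
  rewrite dk// [LHS](_ : _ = \int[nu]_(z in A `*` [set: Y]) k z.1 y)//.
  rewrite Rintegral_mkcond; apply: eq_Rintegral => -[x y'] _ /=.
  by rewrite patchE indicE in_setX/= in_setT andbT; case: ifP; rewrite ?mul1r ?mul0r.
apply/eqP; rewrite -subr_eq0 -bmf_RintegralB; last 2 first.
- exact/bmfM/biy/bmf_fst.
- exact/bmfM/bky/bmf_fst.
under eq_Rintegral do rewrite -mulrBr.
rewrite -normr_le0; apply/ler_addgt0Pl => e e0; rewrite addr0.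
have [I [J [c [mJ hc]]]] := bmf_discretize bh e0.
have bc := bmf_fst (bmf_finite_range mJ c).
have c0 : \int[nu]_z (c (J z.1) * D z) = 0.
  under eq_Rintegral do rewrite finite_rangeE mulr_suml.
  rewrite bmf_Rintegral_sum => [|j]; last first.
    apply: bmfM bD; apply: bmfM; first exact: bmf_cst.
    exact/bmf_fst/bmf_indic.
  rewrite big1// => j _; under eq_Rintegral do rewrite -mulrA.
  rewrite bmf_RintegralZl ?DA ?mulr0//.
  by apply: bmfM bD; exact/bmf_fst/bmf_indic.
have bhD : bmf (fun z : XYT X Y => h z.1 * D z) by exact/bmfM/bD/bmf_fst.
have bcD : bmf (fun z : XYT X Y => c (J z.1) * D z) by exact/bmfM/bD.
rewrite -[X in `|X|]subr0 -c0 -bmf_RintegralB//.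
rewrite -(Rintegral_prob_cst nu e).
apply: le_trans (le_normr_Rintegral _ _) _ => //.
  exact: (bmf_integrable nu (bmfB bhD bcD)).
have [mB [M hM]] := bmfB bhD bcD.
apply: (@bmf_le_Rintegral _ _ _ nu); [|exact: bmf_cst|].
  split; first exact: measurableT_comp.
  by exists M => z; rewrite normr_id.
move=> z; rewrite -mulrBl normrM.
have := D1 z; have /andP[h1 h2] := hc z.1; have hh : `|h z.1 - c (J z.1)| <= e.
  by rewrite ler_norml; lra.
by move=> d1; rewrite -[leRHS]mulr1 ler_pM.
Qed.

Lemma disintegration_Rintegral nu k (phi : borelT X -> Y -> R) :
  disintegration nu k -> (forall y, bmf (fun x => phi x y)) ->
  \int[nu]_z phi z.1 z.2 =
  \int[nu]_z \sum_(y <- fset_set [set: Y]) phi z.1 y * k z.1 y.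
Proof.
move=> dk bphi.
rewrite bmf_Rintegral_sum => [|y]; last first.
  by apply: bmfM; [exact: (bmf_fst (bphi y))|exact: (bmf_fst (bmf_simplex y dk.1))].
under [RHS]eq_bigr do rewrite -(disintegration_slice _ dk (bphi _)).
rewrite -bmf_Rintegral_sum => [|y]; last first.
  by apply: bmfM; [exact: (bmf_fst (bphi y))|exact: bmf_indic_snd].
apply: eq_Rintegral => -[x y'] _ /=.
rewrite (big_fsetD1 y')/=; last by rewrite in_fset_set// in_setT.
rewrite indicE mem_set// mulr1 big1_fset ?addr0// => y.
rewrite !inE => /andP[yy' _] _; rewrite indicE memNset ?mulr0//=.
by apply/eqP; rewrite eq_sym.
Qed.

Lemma bmf_fst_snd (phi : borelT X -> Y -> R) : (forall y, bmf (fun x => phi x y)) ->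
  bmf (fun z : XYT X Y => phi z.1 z.2).
Proof.
move=> bphi; rewrite (_ : (fun z => _) = fun z : XYT X Y =>
    \sum_(y <- fset_set [set: Y]) phi z.1 y * \1_[set y] z.2).
  apply: bmf_sum => y.
  by apply: bmfM; [exact: (bmf_fst (bphi y))|exact: bmf_indic_snd].
apply/funext => -[x y'] /=.
rewrite (big_fsetD1 y')/=; last by rewrite in_fset_set// in_setT.
rewrite indicE mem_set// mulr1 big1_fset ?addr0// => y.
rewrite !inE => /andP[yy' _] _; rewrite indicE memNset ?mulr0//=.
by apply/eqP; rewrite eq_sym.
Qed.

End disintegration.

Lemma bmf_norm {R : realType} {d} {T : measurableType d} (f : T -> R) :
  bmf f -> bmf (fun z => `|f z|).
Proof.
move=> [mf [M fM]]; split; first exact: measurableT_comp.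
by exists M => z; rewrite normr_id.
Qed.

Lemma bmf_ltr {R : realType} {d} {T : measurableType d} (f g : T -> R) :
  bmf f -> bmf g -> bmf (fun z => (f z < g z)%R%:R : R).
Proof.
move=> [mf _] [mg _]; split; last first.
  by exists 1 => z; case: (_ < _); rewrite ?normr1 ?normr0.
rewrite (_ : (fun z => _) = fun z => if (f z < g z)%R then 1 else 0 : R).
  by apply: measurable_fun_ifT => //; exact: measurable_fun_ltr.
by apply/funext => z; case: (_ < _).
Qed.

Section test_function.
Context {R : realType} {X : completePseudoMetricType R} {Y : pointedType}
  (finY : finite_set [set: Y]).
Implicit Types p q k : X -> Y -> R.

Lemma bmf_upper_mass p q k : simplex_map p -> simplex_map q -> simplex_map k ->
  bmf (fun x : borelT X => upper_mass (p x) (q x) (k x)).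
Proof.
move=> sp sq sk; apply: bmf_sum => y; apply: bmfM; last exact: bmf_simplex.
by apply: bmf_ltr; exact: bmf_simplex.
Qed.

Lemma bmf_tv p q : simplex_map p -> simplex_map q ->
  bmf (fun x : borelT X => tv (p x) (q x)).
Proof.
move=> sp sq; under eq_fun do rewrite tvE//.
apply: bmfM; first exact: bmf_cst.
by apply: bmf_sum => y; apply/bmf_norm/bmfB; exact: bmf_simplex.
Qed.

(* By the Donsker-Varadhan formula, [f] shows that the entropy of [nu] given
   [PXY] is at least [2 eps ^ 2 - 4 zeta]. *)
Lemma test_function (PXY nu : probability (XYT X Y) R) p q k (eps zeta : R) :
  disintegration PXY p -> disintegration nu k -> simplex_map q -> 0 < eps < 1 ->
  \int[nu]_z tv (k z.1) (q z.1) <= zeta ->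
  eps <= \int[PXY]_z tv (p z.1) (q z.1) ->
  exists f : XYT X Y -> R, [/\ bmf f, - (4 * zeta) <= \int[nu]_z f z &
    \int[PXY]_z expR (f z) <= expR (- (2 * eps ^+ 2))].
Proof.
move=> dp dk sq heps hzeta hdelta.
have sp := dp.1; have sk := dk.1.
have [al [be [be0 albe maj]]] := affine_majorant heps.
pose b (x : borelT X) := upper_mass (p x) (q x) (q x).
pose g (x : borelT X) := tv (p x) (q x).
pose l (x : borelT X) := tilt eps (g x).
have g0 x : 0 <= g x by exact: tv_ge0.
have g1 x : g x <= 1.
  by apply: tv_le1 => //; [exact: sp.1|exact: sq.1|rewrite sp.2.1|rewrite sq.2.1].
have bg : bmf g by exact: bmf_tv.
have bb : bmf b by exact: bmf_upper_mass.
have l0 x : 0 <= l x by exact: tilt_ge0.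
have l4 x : l x <= 4 by exact: tilt_le4.
have bl : bmf l.
  split; first exact: (measurableT_comp (measurable_tilt eps) bg.1).
  by exists 4 => x; rewrite ger0_norm.
pose phi (x : borelT X) y := l x * ((p x y < q x y)%R%:R - b x).
have bphi y : bmf (fun x => phi x y).
  apply: bmfM => //; apply: bmfB => //.
  by apply: bmf_ltr; exact: bmf_simplex.
exists (fun z => phi z.1 z.2); split; first exact: bmf_fst_snd.
- rewrite (disintegration_Rintegral finY dk bphi).
  under eq_Rintegral do rewrite sum_upper_centered ?sk.2.1//.
  have btv := bmf_fst (bmf_tv sk sq).
  (* Pointwise, [k(A) - b >= - tv k q] by [upper_mass_tv], and [0 <= l <= 4]. *)
  apply: (@le_trans _ _ (\int[nu]_z (- 4 * tv (k z.1) (q z.1)))).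
    by rewrite bmf_RintegralZl// mulNr lerN2 ler_wpM2l.
  apply: (@bmf_le_Rintegral _ _ _ nu).
  - by apply: bmfM => //; exact: bmf_cst.
  - apply: (bmf_fst (h := fun x => l x * (upper_mass (p x) (q x) (k x) - b x))).
    by apply: bmfM => //; apply: bmfB => //; exact: bmf_upper_mass.
  move=> z; have := @upper_mass_tv _ _ finY (p z.1) (q z.1) (k z.1).
  rewrite sk.2.1 sq.2.1 => /(_ erefl); rewrite -/(b _).
  have := tv_ge0 finY (k z.1) (q z.1); have := l0 z.1; have := l4 z.1; nra.
- rewrite (disintegration_Rintegral finY dp (fun y => bmf_expR (bphi y))).
  under eq_Rintegral do rewrite sum_expR_upper ?sp.2.1//.
  have bgz := bmf_fst bg.
  apply: (@le_trans _ _ (\int[PXY]_z (al - be * g z.1))).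
    apply: (@bmf_le_Rintegral _ _ _ PXY).
    + apply: (bmf_fst (h := fun x => expR (- (l x * b x)) *
        (1 - upper_mass (p x) (q x) (p x) + upper_mass (p x) (q x) (p x) * expR (l x)))).
      have bu := bmf_upper_mass sp sq sp.
      apply: bmfM; first exact/bmf_expR/bmfN/bmfM.
      apply: bmfD; first by apply: bmfB => //; exact: bmf_cst.
      by apply: bmfM => //; exact: bmf_expR.
    + by apply: bmfB; [exact: bmf_cst|apply: bmfM => //; exact: bmf_cst].
    move=> z.
    have gE : g z.1 = b z.1 - upper_mass (p z.1) (q z.1) (p z.1).
      by rewrite /g -upper_massB// sp.2.1 sq.2.1.
    rewrite /l gE; apply: maj.
    + exact/upper_mass_ge0/sp.1.
    + by rewrite -subr_ge0 -gE.
    + by apply: upper_mass_le1 => //; [exact: sq.1|exact: sq.2.1].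
  rewrite bmf_RintegralB//; [|exact: bmf_cst|by apply: bmfM => //; exact: bmf_cst].
  rewrite Rintegral_prob_cst bmf_RintegralZl//; apply: le_trans albe.
  by rewrite lerD2l lerN2 ler_wpM2l.
Qed.

End test_function.

(** * Conclusion *)

Lemma limn_esup_le_near {R : realType} (u : (\bar R)^nat) (x : \bar R) :
  (\forall n \near \oo, u n <= x)%E -> (limn_esup u <= x)%E.
Proof.
move=> ux; apply: ereal_inf_le; exists (ereal_sup (u @` [set n | (u n <= x)%E])).
  by exists [set n | (u n <= x)%E].
by apply: ge_ereal_sup => _ [n un <-].
Qed.

Lemma thin_limn_esup {R : realType} {d dO} {T : measurableType d}
  {Om : measurableType dO} (P : probability Om R)
  (L : nat -> Om -> probability T R) (c e : R) (S : set (probability T R)) :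
  thin P L c S -> 0 < e ->
  (limn_esup (fun m => scaled_log m (outer_prob P [set w | S (L m w)])) <=
   (e - c)%:E)%E.
Proof.
move=> [C hC] e0; apply: limn_esup_le_near.
(* The maximum makes the logarithm of the constant meaningful; it is absorbed by [e n] as soon as
   [n >= ln C1 / e]. *)
pose C1 := Num.max C 1.
have C10 : 0 < C1 by rewrite lt_max ltr01 orbT.
have e1 : (ln C1 / e < (Num.trunc (ln C1 / e)).+1%:R) by exact: truncnS_gt.
exists (Num.trunc (ln C1 / e)).+1 => // n /= Kn.
have n0 : (0 < n)%N by exact: leq_trans Kn.
have nR : 0 < n%:R :> R by rewrite ltr0n.
have := hC n n0; have := outer_prob_ge0 P [set w | S (L n w)].
case: (outer_prob _ _) => [r| |] //=; rewrite !lee_fin => r0 rC.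
case: ifPn => [{}r0|_]; last exact: leNye.
rewrite lee_fin ler_pdivrMr//.
apply: (@le_trans _ _ (ln (C1 * expR (- c) ^+ n))).
  rewrite ler_ln ?posrE ?mulr_gt0 ?exprn_gt0 ?expR_gt0//.
  by apply: le_trans rC _; rewrite ler_wpM2r ?exprn_ge0 ?expR_ge0// le_max lexx.
rewrite lnM ?posrE ?exprn_gt0 ?expR_gt0// -expRM_natl expRK.
have : ln C1 <= e * n%:R.
  rewrite -ler_pdivrMl// mulrC (le_trans (ltW e1))// ler_nat//.
lra.
Qed.
Theorem theorem3
  (R : realType)
  (X : completePseudoMetricType R) (Y : pointedType)
  (polishX : polish X) (finY : finite_set [set: Y])
  (PXY : probability (XYT X Y) R)
  (pYX : X -> Y -> R) (hpYX : disintegration PXY pYX)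
  (full_support : topsupport (marg PXY) = setT)
  (cond : probability (XYT X Y) R -> X -> Y -> R)
  (hcond : forall nu, disintegration nu (cond nu))
  (eps zeta : R) (heps : 0 < eps < 1) (hzeta : 0 < zeta < 1)
  (F : probability (XYT X Y) R -> X -> Y -> R)
  (hFL1 : forall nu, simplex_map (F nu))
  (hFcont : tau_continuous PXY F)
  (hF1 : forall (nu : probability (XYT X Y) R) (x : X), topsupport (marg nu) x ->
           tv (cond nu x) (F nu x) <= tv (pYX x) (F nu x))
  (hF2 : forall nu : probability (XYT X Y) R,
           (\int[nu]_z (tv (cond nu z.1) (F nu z.1))%:E <= zeta%:E)%E)
  (dO : measure_display) (Om : measurableType dO) (P : probability Om R)
  (Z : nat -> Om -> XYT X Y) (hZ : iid_seq P Z PXY)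
  (L : nat -> Om -> probability (XYT X Y) R) (hL : empirical Z L) :
  (limn_esup (fun m : nat =>
     scaled_log m (outer_prob P
       [set w | (eps%:E <= delta_bar PXY pYX (F (L m w)))%E]))
   <= (4 * zeta - 2 * eps ^+ 2)%:E)%E.

Proof.
have bF nu nu' := bmf_fst (bmf_tv finY (hFL1 nu) (hFL1 nu')).
have bp nu := bmf_fst (bmf_tv finY hpYX.1 (hFL1 nu)).
have deltaE nu : delta_bar PXY pYX (F nu) =
    (\int[PXY]_z tv (pYX z.1) (F nu z.1))%:E by exact: bmf_integralE.
have distE nu nu' : L1dist PXY (F nu) (F nu') =
    (\int[PXY]_z tv (F nu z.1) (F nu' z.1))%:E by exact: bmf_integralE.
pose Gamma := [set nu | (eps%:E <= delta_bar PXY pYX (F nu))%E].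
have thinG c : c < 2 * eps ^+ 2 - 4 * zeta -> thin P L c Gamma.
  move=> hc; apply: contrapT => /(not_thin_limit hZ hL)[nu [nuG nuent]].
  (* [Gamma] is tau-closed: otherwise a tau-neighbourhood of [nu] is mapped within the missing
     distance of [F nu], and a point [mu] of [Gamma] in it violates the triangle inequality. *)
  have nuGamma : Gamma nu.
    rewrite /Gamma/= deltaE lee_fin leNgt; apply/negP => lt.
    have e0 : 0 < eps - \int[PXY]_z tv (pYX z.1) (F nu z.1) by rewrite subr_gt0.
    have [k [f [r [c' [hf hnbhd]]]]] := hFcont nu _ e0.
    have tauE mu i : tau_basic (f i) (r i) (c' i) mu <->
        `|\int[mu]_z f i z - r i| < c' i.
      by rewrite /tau_basic/= bmf_integralE; [rewrite -EFinB|exact: (hf i).1].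
    (* These radii leave room for the distance of the integral under [nu] from the centre [r i], so
       [mu] falls in each basic set. *)
    have [mu Gmu hmu] := nuG k f (fun i => c' i - `|\int[nu]_z f i z - r i|)
      (fun i => (hf i).1) (fun i => ltac:(by rewrite subr_gt0; apply/tauE; exact: (hf i).2.2)).
    have : (L1dist PXY (F mu) (F nu) < (eps - \int[PXY]_z tv (pYX z.1) (F nu z.1))%:E)%E.
      apply: hnbhd => i; apply/tauE; have := hmu i.
      rewrite ltrBrDr => /(le_lt_trans _); apply.
      exact: ler_distD.
    move: Gmu; rewrite /Gamma/= distE deltaE lte_fin lee_fin ltrBrDr => h1.
    apply/negP; rewrite -leNgt; apply: le_trans h1 _.
    rewrite addrC -bmf_RintegralD//; apply: bmf_le_Rintegral => //.
      exact: bmfD.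
    by move=> z; rewrite (tv_sym finY (F mu z.1)); exact: tv_triangle.
  have zetaR : \int[nu]_z tv (cond nu z.1) (F nu z.1) <= zeta.
    rewrite -lee_fin -bmf_integralE ?hF2//.
    exact: bmf_fst (bmf_tv finY (hcond nu).1 (hFL1 nu)).
  move: nuGamma; rewrite /Gamma/= deltaE lee_fin => nuGamma.
  have [f [bf f1 f2]] := test_function finY hpYX (hcond nu) (hFL1 nu) heps zetaR nuGamma.
  (* Comparing exponents gives [- 4 zeta - c <= - 2 eps^2], against the choice of [c]. *)
  have := le_trans (nuent f bf) f2; rewrite ler_expR; lra.
apply/lee_addgt0Pr => e e0; rewrite -EFinD.
have e20 : 0 < e / 2 by rewrite divr_gt0.
(* Half of [e] keeps [c] strictly below the critical rate, the other half absorbs the constant of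
   [thin]. *)
have := thin_limn_esup (thinG (2 * eps ^+ 2 - 4 * zeta - e / 2) _) e20.
move=> h; apply: le_trans (h _) _; first by rewrite ltrBlDr ltrDl.
by rewrite lee_fin; lra.
Qed.
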